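(* Let $\mathfrak g=\mathfrak{pe}(2)$, let $\mu=\mu_1\varepsilon_1+\mu_2\varepsilon_2\in\mathfrak h^\ast$ and let $s$ be the simple reflection associated to $\varepsilon_1-\varepsilon_2$. (i) If $\mu_1-\mu_2\notin\mathbb Z_{\ge0}$, then $L_\mu=M_\mu$. (ii) If $\mu_1-\mu_2\in\mathbb Z_{>0}$, then $\mathrm{ch}L_\mu=\mathrm{ch}M_\mu-\mathrm{ch}M_{s\cdot\mu}$. (iii) If $\mu_1=\mu_2$, then $\mathrm{ch}L_\mu=e^\mu$.
   Context: The ground field is $\mathbb C$. The periplectic Lie superalgebra $\mathfrak g=\mathfrak{pe}(2)\subset\mathfrak{gl}(2|2)$ consists of the matrices $\begin{pmatrix}a&b\\ c&-a^t\end{pmatrix}$ with $b$ symmetric and $c$ skew-symmetric ($a,b,c\in\mathbb C^{2\times2}$); $\mathfrak g_{\bar0}\cong\mathfrak{gl}(2)$ is given by $b=c=0$ and $\mathfrak g_1$ by $a=c=0$. $\mathfrak h$ is the diagonal Cartan subalgebra with basis $e_{ii}=E_{ii}-E_{2+i,2+i}$ and dual basis $\varepsilon_1,\varepsilon_2$. The Borel subalgebra $\mathfrak b_{\bar0}\subset\mathfrak g_{\bar0}$ corresponds to the positive even root $\varepsilon_1-\varepsilon_2$, and $\mathfrak b=\mathfrak b_{\bar0}\oplus\mathfrak g_1$. The dot action is $s\cdot\mu=s(\mu+\rho_{\bar0})-\rho_{\bar0}$ with $\rho_{\bar0}=\frac12(\varepsilon_1-\varepsilon_2)$, i.e. $s\cdot\mu=(\mu_2-1)\varepsilon_1+(\mu_1+1)\varepsilon_2$.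 $M_\mu=U(\mathfrak g)\otimes_{U(\mathfrak b)}\mathbb C_\mu$ is the Verma module and $L_\mu$ its unique simple quotient. For a weight module $M$ with finite dimensional weight spaces, $\mathrm{ch}M=\sum_{\nu\in\mathfrak h^\ast}\dim M^\nu e^\nu$. *)

(* Defs.v *)
From HB Require Import structures.
From mathcomp Require Import all_boot all_order all_algebra.
From mathcomp Require Import perm boolp classical_sets.

Set Implicit Arguments.
Unset Strict Implicit.
Unset Printing Implicit Defensive.

Import GRing.Theory.
Local Open Scope ring_scope.
Local Open Scope quotient_scope.

Section GeneralLinear.
Variables (F : fieldType) (m n : nat).
Implicit Types x y : 'M[F]_(m + n).

Definition homog (p : bool) x : bool :=
  if p then (ulsubmx x == 0) && (drsubmx x == 0)
  else (ursubmx x == 0) && (dlsubmx x == 0).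

(* The superbracket of x, y in gl(m|n), homogeneous of parities p, q. *)
Definition sbracket (p q : bool) x y : 'M[F]_(m + n) :=
  x *m y - (-1) ^+ (p && q) *: (y *m x).

Record subsuperalgebra := SubSuperAlgebra {
  carrier : {pred 'M[F]_(m + n)};
  carrier_submod : GRing.submod_closed carrier;
  carrier_graded : forall x, x \in carrier ->
    exists x0 x1, [/\ x0 \in carrier, x1 \in carrier,
                      homog false x0, homog true x1 & x = x0 + x1];
  carrier_bracket : forall p q x y, x \in carrier -> y \in carrier ->
    homog p x -> homog q y -> sbracket p q x y \in carrier
}.

Definition elt (S : subsuperalgebra) : Type := {x | x \in carrier S}.

End GeneralLinear.

(* U S is the universal enveloping algebra of S: the unital associative
   F-algebra generated by S subject to the relations listed in [uequiv].
   Its modules are the objects of type lmodType (U S); F acts through [ucst]. *)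
Section Enveloping.
Variables (F : fieldType) (m n : nat) (S : subsuperalgebra F m n).

Inductive uterm : Type :=
| UGen of elt S
| UCst of F
| UAdd of uterm & uterm
| UMul of uterm & uterm.

Inductive uequiv : uterm -> uterm -> Prop :=
| ue_refl t : uequiv t t
| ue_sym t u : uequiv t u -> uequiv u t
| ue_trans t u v : uequiv t u -> uequiv u v -> uequiv t v
| ue_add t t' u u' : uequiv t t' -> uequiv u u' -> uequiv (UAdd t u) (UAdd t' u')
| ue_mul t t' u u' : uequiv t t' -> uequiv u u' -> uequiv (UMul t u) (UMul t' u')
(* F-algebra laws *)
| ue_addA t u v : uequiv (UAdd t (UAdd u v)) (UAdd (UAdd t u) v)
| ue_addC t u : uequiv (UAdd t u) (UAdd u t)
| ue_add0 t : uequiv (UAdd (UCst 0) t) t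
| ue_mulA t u v : uequiv (UMul t (UMul u v)) (UMul (UMul t u) v)
| ue_mul1l t : uequiv (UMul (UCst 1) t) t
| ue_mul0l t : uequiv (UMul (UCst 0) t) (UCst 0)
| ue_mulDl t u v : uequiv (UMul (UAdd t u) v) (UAdd (UMul t v) (UMul u v))
| ue_mulDr t u v : uequiv (UMul t (UAdd u v)) (UAdd (UMul t u) (UMul t v))
| ue_cstD a b : uequiv (UCst (a + b)) (UAdd (UCst a) (UCst b))
| ue_cstM a b : uequiv (UCst (a * b)) (UMul (UCst a) (UCst b))
| ue_cstC a t : uequiv (UMul (UCst a) t) (UMul t (UCst a))
(* the inclusion of S is linear and compatible with the superbracket *)
| ue_genD (x y z : elt S) : sval z = sval x + sval y ->
    uequiv (UGen z) (UAdd (UGen x) (UGen y))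
| ue_genZ a (x z : elt S) : sval z = a *: sval x ->
    uequiv (UGen z) (UMul (UCst a) (UGen x))
| ue_genB (p q : bool) (x y z : elt S) :
    homog p (sval x) -> homog q (sval y) ->
    sval z = sbracket p q (sval x) (sval y) ->
    uequiv (UMul (UGen x) (UGen y))
      (UAdd (UMul (UCst ((-1) ^+ (p && q))) (UMul (UGen y) (UGen x))) (UGen z)).

HB.instance Definition _ := gen_eqMixin uterm.
HB.instance Definition _ := gen_choiceMixin uterm.

Definition ueqb (t u : uterm) : bool := `[< uequiv t u >].

Lemma ueqb_refl : ssrbool.reflexive ueqb.
Proof. by move=> t; apply/asboolP/ue_refl. Qed.

Lemma ueqb_sym : ssrbool.symmetric ueqb.
Proof. by move=> t u; apply/asboolP/asboolP; apply: ue_sym. Qed.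

Lemma ueqb_trans : ssrbool.transitive ueqb.
Proof.
by move=> u t v /asboolP tu /asboolP uv; apply/asboolP/(ue_trans tu uv).
Qed.

Definition ueq_rel := EquivRel ueqb ueqb_refl ueqb_sym ueqb_trans.

Definition U : Type := {eq_quot ueq_rel}.
HB.instance Definition _ := Choice.on U.

Definition upi (t : uterm) : U := \pi_({eq_quot ueq_rel}) t.

Lemma upiP t u : (upi t = upi u) <-> uequiv t u.
Proof.
by rewrite /upi; split=> [/eqquotP/asboolP|tu]; last by apply/eqquotP/asboolP.
Qed.

Lemma upi_surj (x : U) : exists t, x = upi t.
Proof. by exists (repr (x : {eq_quot ueq_rel})); rewrite /upi reprK. Qed.

Definition urepr (x : U) : uterm := repr (x : {eq_quot ueq_rel}).

Lemma ureprK x : upi (urepr x) = x.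
Proof. by rewrite /upi /urepr reprK. Qed.

Lemma urepr_pi t : uequiv (urepr (upi t)) t.
Proof. by apply/upiP; rewrite ureprK. Qed.

Definition uadd (x y : U) := upi (UAdd (urepr x) (urepr y)).
Definition umul (x y : U) := upi (UMul (urepr x) (urepr y)).
Definition uopp (x : U) := umul (upi (UCst (-1))) x.

Lemma upi_add t u : upi (UAdd t u) = uadd (upi t) (upi u).
Proof. by apply/upiP/ue_add; apply/ue_sym/urepr_pi. Qed.

Lemma upi_mul t u : upi (UMul t u) = umul (upi t) (upi u).
Proof. by apply/upiP/ue_mul; apply/ue_sym/urepr_pi. Qed.

Local Ltac uquot :=
  hnf; intros; repeat match goal with
  | x : U |- _ => let t := fresh "t" in have [t ?] := upi_surj x; subst x end;
  rewrite -?(upi_mul, upi_add); apply/upiP.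

Lemma uaddA : associative uadd.
Proof. uquot; exact: ue_addA. Qed.
Lemma uaddC : commutative uadd.
Proof. uquot; exact: ue_addC. Qed.
Lemma uadd0 : left_id (upi (UCst 0)) uadd.
Proof. uquot; exact: ue_add0. Qed.
Lemma umulA : associative umul.
Proof. uquot; exact: ue_mulA. Qed.
Lemma umul1l : left_id (upi (UCst 1)) umul.
Proof. uquot; exact: ue_mul1l. Qed.
Lemma umul1r : right_id (upi (UCst 1)) umul.
Proof. uquot; apply: ue_trans (ue_mul1l _); exact/ue_sym/ue_cstC. Qed.
Lemma umulDl : left_distributive umul uadd.
Proof. uquot; exact: ue_mulDl. Qed.
Lemma umulDr : right_distributive umul uadd.
Proof. uquot; exact: ue_mulDr. Qed.
Lemma uaddN : left_inverse (upi (UCst 0)) uopp uadd.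
Proof.
move=> x; rewrite /uopp -[X in uadd _ X]umul1l -umulDl.
have [t ->] := upi_surj x; rewrite -upi_add -upi_mul; apply/upiP.
apply: ue_trans (ue_mul0l t); apply: ue_mul (ue_refl t).
by apply: ue_trans (ue_sym (ue_cstD _ _)) _; rewrite addNr; apply: ue_refl.
Qed.

HB.instance Definition _ := GRing.isZmodule.Build U uaddA uaddC uadd0 uaddN.
HB.instance Definition _ := GRing.Zmodule_isPzRing.Build U
  umulA umul1l umul1r umulDl umulDr.

Definition ugen (x : elt S) : U := upi (UGen x).
Definition ucst (a : F) : U := upi (UCst a).

Lemma ugenD (x y z : elt S) :
  sval z = sval x + sval y -> ugen z = ugen x + ugen y.
Proof. by move=> e; rewrite -[RHS]upi_add; apply/upiP/ue_genD. Qed.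

Lemma ugenZ a (x z : elt S) : sval z = a *: sval x -> ugen z = ucst a * ugen x.
Proof. by move=> e; rewrite -[RHS]upi_mul; apply/upiP/ue_genZ. Qed.

Lemma ugenB p q (x y z : elt S) : homog p (sval x) -> homog q (sval y) ->
  sval z = sbracket p q (sval x) (sval y) ->
  ugen x * ugen y = ucst ((-1) ^+ (p && q)) * (ugen y * ugen x) + ugen z.
Proof.
move=> hx hy e; rewrite -[ugen x * _]upi_mul -[ugen y * _]upi_mul.
by rewrite -[ucst _ * _]upi_mul -[RHS]upi_add; apply/upiP/(ue_genB hx hy e).
Qed.

Lemma ucstC a x : ucst a * x = x * ucst a.
Proof.
have [t ->] := upi_surj x; rewrite -[LHS]upi_mul -[RHS]upi_mul.
exact/upiP/ue_cstC.
Qed.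

Lemma ucst_is_zmod : zmod_morphism ucst.
Proof.
move=> a b; apply: (canRL (addrK _)); rewrite -[in RHS](subrK b a).
by rewrite -[LHS]upi_add; apply/upiP/ue_sym/ue_cstD.
Qed.

Lemma ucst_is_monoid : monoid_morphism ucst.
Proof. by split=> // a b; rewrite -[RHS]upi_mul; apply/upiP/ue_cstM. Qed.

HB.instance Definition _ := GRing.isZmodMorphism.Build F U ucst ucst_is_zmod.
HB.instance Definition _ :=
  GRing.isMonoidMorphism.Build F U ucst ucst_is_monoid.

Section Lift.
Variables (A : pzRingType) (c : {rmorphism F -> A}) (f : elt S -> A).
Hypothesis cC : forall a x, c a * x = x * c a.
Hypothesis fD : forall x y z, sval z = sval x + sval y -> f z = f x + f y.
Hypothesis fZ : forall a x z, sval z = a *: sval x -> f z = c a * f x.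
Hypothesis fB : forall (p q : bool) x y z,
  homog p (sval x) -> homog q (sval y) ->
  sval z = sbracket p q (sval x) (sval y) ->
  f x * f y = c ((-1) ^+ (p && q)) * (f y * f x) + f z.

Fixpoint ueval (t : uterm) : A :=
  match t with
  | UGen x => f x
  | UCst a => c a
  | UAdd t u => ueval t + ueval u
  | UMul t u => ueval t * ueval u
  end.

Lemma ueval_equiv t u : uequiv t u -> ueval t = ueval u.
Proof.
elim=> {t u} //=; try by move=> *; congruence.
- by move=> *; rewrite addrA.
- by move=> *; rewrite addrC.
- by move=> *; rewrite rmorph0 add0r.
- by move=> *; rewrite mulrA.
- by move=> *; rewrite rmorph1 mul1r.
- by move=> *; rewrite rmorph0 mul0r.
- by move=> *; rewrite mulrDl.
- by move=> *; rewrite mulrDr.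
- by move=> *; rewrite rmorphD.
- by move=> *; rewrite rmorphM.
Qed.

Definition ulift (x : U) : A := ueval (urepr x).

Lemma ulift_pi t : ulift (upi t) = ueval t.
Proof. exact/ueval_equiv/urepr_pi. Qed.

Lemma ulift_is_zmod : zmod_morphism ulift.
Proof.
move=> x y; apply: (canRL (addrK _)); rewrite -[in RHS](subrK y x).
have [t ->] := upi_surj (x - y); have [u ->] := upi_surj y.
by rewrite -[upi t + _]upi_add !ulift_pi.
Qed.

Lemma ulift_is_monoid : monoid_morphism ulift.
Proof.
split=> [|x y]; first by rewrite -[1]/(upi (UCst 1)) ulift_pi /= rmorph1.
have [t ->] := upi_surj x; have [u ->] := upi_surj y.
by rewrite -[upi t * _]upi_mul !ulift_pi.
Qed.
End Lift.
End Enveloping.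

Section Inclusion.
Variables (F : fieldType) (m n : nat) (S T : subsuperalgebra F m n).
Hypothesis sST : forall x, x \in carrier S -> x \in carrier T.

Definition elt_incl (x : elt S) : elt T := exist _ (sval x) (sST (svalP x)).

Definition uincl : U S -> U T := ulift (@ucst _ _ _ T) (fun x => ugen (elt_incl x)).

Lemma uincl_is_zmod : zmod_morphism uincl.
Proof.
apply: ulift_is_zmod => [a u|x y z|a x z|p q x y z]; first exact: ucstC.
- by move=> e; apply: ugenD.
- by move=> e; apply: ugenZ.
- exact: (@ugenB _ _ _ T p q (elt_incl x) (elt_incl y) (elt_incl z)).
Qed.

Lemma uincl_is_monoid : monoid_morphism uincl.
Proof.
apply: ulift_is_monoid => [a u|x y z|a x z|p q x y z]; first exact: ucstC.
- by move=> e; apply: ugenD.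
- by move=> e; apply: ugenZ.
- exact: (@ugenB _ _ _ T p q (elt_incl x) (elt_incl y) (elt_incl z)).
Qed.

HB.instance Definition _ := GRing.isZmodMorphism.Build (U S) (U T) uincl uincl_is_zmod.
HB.instance Definition _ := GRing.isMonoidMorphism.Build (U S) (U T) uincl uincl_is_monoid.
End Inclusion.

(* The left B-module B (x)_A N, where A acts on B on the right through f. *)
Section Tensor.
Variables (A B : pzRingType) (f : {rmorphism A -> B}) (N : lmodType A).

Inductive tterm : Type :=
| TPure of B & N
| TZero
| TOpp of tterm
| TAdd of tterm & tterm.

Inductive tequiv : tterm -> tterm -> Prop :=
| te_refl t : tequiv t t
| te_sym t u : tequiv t u -> tequiv u t
| te_trans t u v : tequiv t u -> tequiv u v -> tequiv t v
| te_opp t t' : tequiv t t' -> tequiv (TOpp t) (TOpp t')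
| te_add t t' u u' : tequiv t t' -> tequiv u u' -> tequiv (TAdd t u) (TAdd t' u')
(* abelian group laws *)
| te_addA t u v : tequiv (TAdd t (TAdd u v)) (TAdd (TAdd t u) v)
| te_addC t u : tequiv (TAdd t u) (TAdd u t)
| te_add0 t : tequiv (TAdd TZero t) t
| te_addN t : tequiv (TAdd (TOpp t) t) TZero
(* biadditivity and A-balancedness *)
| te_pureDl b b' n : tequiv (TPure (b + b') n) (TAdd (TPure b n) (TPure b' n))
| te_pureDr b n n' : tequiv (TPure b (n + n')) (TAdd (TPure b n) (TPure b n'))
| te_pureM b a n : tequiv (TPure (b * f a) n) (TPure b (a *: n)).

HB.instance Definition _ := gen_eqMixin tterm.
HB.instance Definition _ := gen_choiceMixin tterm.

Definition teqb (t u : tterm) : bool := `[< tequiv t u >].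

Lemma teqb_refl : ssrbool.reflexive teqb.
Proof. by move=> t; apply/asboolP/te_refl. Qed.

Lemma teqb_sym : ssrbool.symmetric teqb.
Proof. by move=> t u; apply/asboolP/asboolP; apply: te_sym. Qed.

Lemma teqb_trans : ssrbool.transitive teqb.
Proof.
by move=> u t v /asboolP tu /asboolP uv; apply/asboolP/(te_trans tu uv).
Qed.

Definition teq_rel := EquivRel teqb teqb_refl teqb_sym teqb_trans.

Definition tensor : Type := {eq_quot teq_rel}.
HB.instance Definition _ := Choice.on tensor.

Definition tpi (t : tterm) : tensor := \pi_({eq_quot teq_rel}) t.
Definition trepr (x : tensor) : tterm := repr (x : {eq_quot teq_rel}).

Lemma tpiP t u : (tpi t = tpi u) <-> tequiv t u.
Proof.
by rewrite /tpi; split=> [/eqquotP/asboolP|tu]; last by apply/eqquotP/asboolP.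
Qed.

Lemma treprK x : tpi (trepr x) = x.
Proof. by rewrite /tpi /trepr reprK. Qed.

Lemma trepr_pi t : tequiv (trepr (tpi t)) t.
Proof. by apply/tpiP; rewrite treprK. Qed.

Lemma tpi_surj (x : tensor) : exists t, x = tpi t.
Proof. by exists (trepr x); rewrite treprK. Qed.

Fixpoint tact (b : B) (t : tterm) : tterm :=
  match t with
  | TPure b' n => TPure (b * b') n
  | TZero => TZero
  | TOpp t => TOpp (tact b t)
  | TAdd t u => TAdd (tact b t) (tact b u)
  end.

Lemma tact_equiv b t u : tequiv t u -> tequiv (tact b t) (tact b u).
Proof.
elim=> {t u} /=.
- by move=> t; apply: te_refl.
- by move=> *; apply: te_sym.
- by move=> t u v _ tu _; apply: te_trans tu.
- by move=> *; apply: te_opp.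
- by move=> *; apply: te_add.
- by move=> *; apply: te_addA.
- by move=> *; apply: te_addC.
- by move=> *; apply: te_add0.
- by move=> *; apply: te_addN.
- by move=> *; rewrite mulrDr; apply: te_pureDl.
- by move=> *; apply: te_pureDr.
- by move=> *; rewrite mulrA; apply: te_pureM.
Qed.

Definition tadd (x y : tensor) := tpi (TAdd (trepr x) (trepr y)).
Definition topp (x : tensor) := tpi (TOpp (trepr x)).
Definition tscale (b : B) (x : tensor) := tpi (tact b (trepr x)).

Lemma tpi_add t u : tpi (TAdd t u) = tadd (tpi t) (tpi u).
Proof. by apply/tpiP/te_add; apply/te_sym/trepr_pi. Qed.

Lemma tpi_opp t : tpi (TOpp t) = topp (tpi t).
Proof. by apply/tpiP/te_opp; apply/te_sym/trepr_pi. Qed.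

Lemma tpi_scale b t : tpi (tact b t) = tscale b (tpi t).
Proof. by apply/tpiP/tact_equiv/te_sym/trepr_pi. Qed.

Local Ltac tquot :=
  hnf; intros; repeat match goal with
  | x : tensor |- _ => let t := fresh "t" in have [t ?] := tpi_surj x; subst x end;
  rewrite -?(tpi_add, tpi_opp, tpi_scale); apply/tpiP.

Lemma taddA : associative tadd.
Proof. tquot; exact: te_addA. Qed.
Lemma taddC : commutative tadd.
Proof. tquot; exact: te_addC. Qed.
Lemma tadd0 : left_id (tpi TZero) tadd.
Proof. tquot; exact: te_add0. Qed.
Lemma taddN : left_inverse (tpi TZero) topp tadd.
Proof. tquot; exact: te_addN. Qed.

HB.instance Definition _ := GRing.isZmodule.Build tensor taddA taddC tadd0 taddN.

Lemma tscaleA a b x : tscale a (tscale b x) = tscale (a * b) x.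
Proof.
tquot; elim: t => [b' n||t IH|t IHt u IHu] /=.
- by rewrite mulrA; apply: te_refl.
- exact: te_refl.
- exact: te_opp.
- exact: te_add.
Qed.

Lemma tscale1 : left_id 1 tscale.
Proof.
tquot; elim: t => [b' n||t IH|t IHt u IHu] /=.
- by rewrite mul1r; apply: te_refl.
- exact: te_refl.
- exact: te_opp.
- exact: te_add.
Qed.

Lemma tscaleDr : right_distributive tscale +%R.
Proof.
move=> b x y; rewrite -[x + y]/(tadd x y) -[RHS]/(tadd _ _).
by have [t ->] := tpi_surj x; have [u ->] := tpi_surj y; rewrite -?(tpi_add, tpi_scale).
Qed.

Lemma tscaleDl x : {morph tscale^~ x : a b / a + b}.
Proof.
move=> a b; have [t ->] := tpi_surj x.
elim: t => [b' n||t IH|t IHt u IHu].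
- rewrite -!tpi_scale -[RHS]tpi_add /= mulrDl; exact/tpiP/te_pureDl.
- by rewrite -!tpi_scale -[RHS]tpi_add; apply/tpiP/te_sym/te_add0.
- move: IH; rewrite -!tpi_scale /= !tpi_opp => ->.
  exact: (@opprD tensor).
- move: IHt IHu; rewrite -!tpi_scale /= !tpi_add => -> ->.
  exact: (@addrACA tensor).
Qed.

HB.instance Definition _ :=
  GRing.Zmodule_isLmodule.Build B tensor tscaleA tscale1 tscaleDr tscaleDl.

Definition pure (b : B) (n : N) : tensor := tpi (TPure b n).
End Tensor.

Section SimpleModule.
Variables (A : pzRingType) (M : lmodType A).

Definition simple_module : Prop :=
  (exists x : M, x != 0) /\
  forall N : {pred M}, GRing.submod_closed N ->
    (forall x, x \in N -> x = 0) \/ (forall x, x \in N).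
End SimpleModule.

Section Periplectic.
Variables (F : fieldType) (n : nat).
Implicit Types x y : 'M[F]_(n + n).

(* x is of the form (a, b; c, - a^t), b symmetric, c skew-symmetric *)
Definition in_pe : {pred 'M[F]_(n + n)} := fun x =>
  [&& drsubmx x == - (ulsubmx x)^T, (ursubmx x)^T == ursubmx x
    & (dlsubmx x)^T == - dlsubmx x].

(* b_0 + g_1: a is upper triangular and c = 0 *)
Definition in_borel : {pred 'M[F]_(n + n)} := fun x =>
  [&& x \in in_pe, is_trig_mx (ulsubmx x)^T & dlsubmx x == 0].

Lemma in_peP x : reflect (exists a b c,
    [/\ b^T = b, c^T = - c & x = block_mx a b c (- a^T)]) (x \in in_pe).
Proof.
apply: (iffP and3P) => [[/eqP d /eqP b /eqP c]|[a [b [c [hb hc ->]]]]].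
  by exists (ulsubmx x), (ursubmx x), (dlsubmx x); rewrite -d submxK.
by rewrite block_mxKul block_mxKur block_mxKdl block_mxKdr hb hc !eqxx.
Qed.

Lemma homog_block p (a b c d : 'M[F]_n) : homog p (block_mx a b c d) =
  if p then (a == 0) && (d == 0) else (b == 0) && (c == 0).
Proof.
by rewrite /homog block_mxKul block_mxKur block_mxKdl block_mxKdr.
Qed.

Lemma pe_submod : GRing.submod_closed in_pe.
Proof.
split=> [|k x y /in_peP[a [b [c [hb hc ->]]]] /in_peP[a' [b' [c' [hb' hc' ->]]]]].
  apply/in_peP; exists 0, 0, 0; rewrite !trmx0 oppr0; split=> //.
  by rewrite block_mx0.
apply/in_peP; exists (k *: a + a'), (k *: b + b'), (k *: c + c').
rewrite !linearD !linearZ /= hb hb' hc hc' scalerN -opprD; split=> //.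
by rewrite scale_block_mx add_block_mx scalerN.
Qed.

Lemma pe_graded x : x \in in_pe -> exists x0 x1,
  [/\ x0 \in in_pe, x1 \in in_pe, homog false x0, homog true x1 & x = x0 + x1].
Proof.
move=> /in_peP[a [b [c [hb hc ->]]]].
exists (block_mx a 0 0 (- a^T)), (block_mx 0 b c 0); split.
- by apply/in_peP; exists a, 0, 0; rewrite trmx0 oppr0.
- by apply/in_peP; exists 0, b, c; rewrite trmx0 oppr0.
- by rewrite homog_block !eqxx.
- by rewrite homog_block !eqxx.
- by rewrite add_block_mx !addr0 !add0r.
Qed.

Lemma sbracket_block p q (a b c d a' b' c' d' : 'M[F]_n) :
  sbracket p q (block_mx a b c d) (block_mx a' b' c' d') =
  let s := (-1) ^+ (p && q) in
  block_mx (a *m a' + b *m c' - s *: (a' *m a + b' *m c))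
           (a *m b' + b *m d' - s *: (a' *m b + b' *m d))
           (c *m a' + d *m c' - s *: (c' *m a + d' *m c))
           (c *m b' + d *m d' - s *: (c' *m b + d' *m d)).
Proof.
by rewrite /sbracket !mulmx_block scale_block_mx opp_block_mx add_block_mx.
Qed.

Lemma pe_bracket p q x y : x \in in_pe -> y \in in_pe ->
  homog p x -> homog q y -> sbracket p q x y \in in_pe.
Proof.
move=> /in_peP[a [b [c [hb hc ->]]]] /in_peP[a' [b' [c' [hb' hc' ->]]]].
rewrite !homog_block sbracket_block => hp hq; apply/in_peP.
case: p hp => /andP[/eqP h1 /eqP h2]; case: q hq => /andP[/eqP h3 /eqP h4] /=;
  rewrite ?h2 ?h4; subst.
- exists (b *m c' + b' *m c), 0, 0.
  rewrite !(mul0mx, mulmx0, add0r, addr0, oppr0, expr1, scaleN1r, opprK, trmx0).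
  rewrite linearD /= !trmx_mul hb hc hb' hc' !mulNmx opprD !opprK.
  by split=> //; rewrite addrC [c *m _ + _]addrC.
- exists 0, (- (b *m a'^T) - a' *m b), (c *m a' + a'^T *m c).
  rewrite !(mul0mx, mulmx0, add0r, addr0, oppr0, expr0, scale1r, trmx0).
  rewrite !(linearD, linearN) /= !trmx_mul !trmxK hb hc !(mulmxN, mulNmx, opprK).
  split=> //; first by rewrite addrC.
  by rewrite addrC.
- exists 0, (a *m b' + b' *m a^T), (- (a^T *m c') - c' *m a).
  rewrite !(mul0mx, mulmx0, add0r, addr0, oppr0, expr0, scale1r, trmx0).
  rewrite !(linearD, linearN) /= !trmx_mul !trmxK hb' hc' !(mulmxN, mulNmx, opprK).
  split=> //; first by rewrite addrC.
  by rewrite ?opprK addrC ?opprK.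
- exists (a *m a' - a' *m a), 0, 0.
  rewrite !(mul0mx, mulmx0, add0r, addr0, oppr0, expr0, scale1r, trmx0).
  rewrite linearB /= !trmx_mul opprB !(mulmxN, mulNmx, opprK).
  by split.
Qed.

Definition pe := SubSuperAlgebra pe_submod pe_graded pe_bracket.
Lemma in_borelP x : reflect (exists a b,
    [/\ is_trig_mx a^T, b^T = b & x = block_mx a b 0 (- a^T)]) (x \in in_borel).
Proof.
apply: (iffP and3P) => [[/in_peP[a [b [c [hb hc ->]]]]]|[a [b [ha hb ->]]]].
  by rewrite block_mxKul block_mxKdl => ha /eqP ->; exists a, b.
rewrite block_mxKul block_mxKdl eqxx; split=> //.
by apply/in_peP; exists a, b, 0; rewrite trmx0 oppr0.
Qed.

Lemma borel_pe x : x \in in_borel -> x \in in_pe.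
Proof. by case/and3P. Qed.

Lemma trig_mulmx (a a' : 'M[F]_n) : is_trig_mx a -> is_trig_mx a' ->
  is_trig_mx (a *m a') /\ forall i, (a *m a') i i = a i i * a' i i.
Proof.
move=> /is_trig_mxP ha /is_trig_mxP ha'; split=> [|i].
  apply/is_trig_mxP => i j ltij; rewrite mxE big1 // => k _.
  have [ltik|leki] := ltnP i k; first by rewrite ha // mul0r.
  by rewrite ha' ?mulr0 //; apply: leq_ltn_trans ltij.
rewrite mxE (bigD1 i) //= big1 ?addr0 // => k; rewrite neq_ltn => /orP[ltki|ltik].
  by rewrite ha' ?mulr0.
by rewrite ha ?mul0r.
Qed.

Lemma trig_linear k (a a' : 'M[F]_n) : is_trig_mx a -> is_trig_mx a' ->
  is_trig_mx (k *: a + a').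
Proof.
move=> /is_trig_mxP ha /is_trig_mxP ha'; apply/is_trig_mxP => i j ltij.
by rewrite !mxE ha // ha' // mulr0 addr0.
Qed.

Lemma borel_submod : GRing.submod_closed in_borel.
Proof.
split=> [|k x y].
  apply/in_borelP; exists 0, 0; rewrite !trmx0 oppr0 mx0_is_trig; split=> //.
  by rewrite block_mx0.
move=> /in_borelP[a [b [ha hb ->]]] /in_borelP[a' [b' [ha' hb' ->]]].
apply/in_borelP; exists (k *: a + a'), (k *: b + b').
rewrite !linearD !linearZ /= hb hb' trig_linear // scalerN -opprD; split=> //.
by rewrite scale_block_mx add_block_mx scaler0 addr0 opprD scalerN.
Qed.

Lemma borel_graded x : x \in in_borel -> exists x0 x1,
  [/\ x0 \in in_borel, x1 \in in_borel, homog false x0, homog true x1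
    & x = x0 + x1].
Proof.
move=> /in_borelP[a [b [ha hb ->]]].
exists (block_mx a 0 0 (- a^T)), (block_mx 0 b 0 0); split.
- by apply/in_borelP; exists a, 0; rewrite trmx0.
- by apply/in_borelP; exists 0, b; rewrite trmx0 oppr0 mx0_is_trig.
- by rewrite homog_block !eqxx.
- by rewrite homog_block !eqxx.
- by rewrite add_block_mx !addr0 !add0r.
Qed.

Lemma borel_bracket p q x y : x \in in_borel -> y \in in_borel ->
  homog p x -> homog q y -> sbracket p q x y \in in_borel.
Proof.
move=> hx hy hp hq; apply/and3P; split.
- by apply: pe_bracket; rewrite ?borel_pe.
- move: hx hy => /in_borelP[a [b [ha hb ->]]] /in_borelP[a' [b' [ha' hb' ->]]].
  rewrite sbracket_block block_mxKul !mulmx0 !addr0 linearB linearZ /= !trmx_mul.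
  by rewrite addrC -scaleNr trig_linear //; apply trig_mulmx.
move: hx hy => /in_borelP[a [b [ha hb ->]]] /in_borelP[a' [b' [ha' hb' ->]]].
by rewrite sbracket_block block_mxKdl !mul0mx !mulmx0 !addr0 scaler0 subr0.
Qed.

Definition borel := SubSuperAlgebra borel_submod borel_graded borel_bracket.

(* [nu : 'rV_n] is the weight \sum_i nu_i eps_i; this is its value at x, where
   e_ii = E_ii - E_(n+i,n+i) has i-th coordinate (ulsubmx x) i i. *)
Definition wt_eval (nu : 'rV[F]_n) x : F := \sum_i nu 0 i * ulsubmx x i i.

Lemma wt_evalD nu x y : wt_eval nu (x + y) = wt_eval nu x + wt_eval nu y.
Proof.
by rewrite /wt_eval -big_split; apply: eq_bigr => i _; rewrite !mxE mulrDr.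
Qed.

Lemma wt_evalZ nu a x : wt_eval nu (a *: x) = a * wt_eval nu x.
Proof.
rewrite /wt_eval mulr_sumr; apply: eq_bigr => i _.
by rewrite !mxE mulrCA.
Qed.

Lemma wt_evalB nu p q x y : x \in in_borel -> y \in in_borel ->
  homog p x -> homog q y ->
  wt_eval nu x * wt_eval nu y =
  (-1) ^+ (p && q) * (wt_eval nu y * wt_eval nu x)
    + wt_eval nu (sbracket p q x y).
Proof.
move=> /in_borelP[a [b [ha hb ->]]] /in_borelP[a' [b' [ha' hb' ->]]].
rewrite !homog_block => hp hq; rewrite sbracket_block /wt_eval !block_mxKul.
set w := fun z : 'M[F]_n => \sum_i nu 0 i * z i i.
rewrite -/(w a) -/(w a') -/(w _) /= !mulmx0 !addr0.
have w0 : w 0 = 0 by apply: big1 => i _; rewrite mxE mulr0.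
case: p hp => [/andP[/eqP-> _]|_].
  by rewrite mulmx0 mul0mx scaler0 subr0 !w0 mul0r !mulr0 addr0.
case: q hq => [/andP[/eqP-> _]|_] /=.
  by rewrite mulmx0 mul0mx scaler0 subr0 !w0 mul0r !mulr0 addr0.
suff -> : w (a *m a' - (-1) ^+ 0 *: (a' *m a)) = 0.
  by rewrite expr0 mul1r addr0 mulrC.
apply: big1 => i _; rewrite expr0 scale1r.
have e : (a *m a') i i = (a' *m a) i i.
  rewrite -[a *m a']trmxK trmx_mul mxE (trig_mulmx ha' ha).2.
  by rewrite -[a' *m a]trmxK trmx_mul [RHS]mxE (trig_mulmx ha ha').2 mulrC.
have -> : (a *m a' - a' *m a) i i = (a *m a') i i - (a' *m a) i i.
  by rewrite [LHS]mxE [X in _ + X]mxE.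
by rewrite e subrr mulr0.
Qed.
(* C_nu: h acts through nu, the nilradical of the Borel by 0. *)
Definition bchar (nu : 'rV[F]_n) : U borel -> F :=
  ulift (@idfun F) (fun x : elt borel => wt_eval nu (sval x)).

Lemma bchar_is_rmorphism nu :
  zmod_morphism (bchar nu) /\ monoid_morphism (bchar nu).
Proof.
have hC (a x : F) : idfun a * x = x * idfun a by rewrite mulrC.
have hD (x y z : elt borel) : sval z = sval x + sval y ->
  wt_eval nu (sval z) = wt_eval nu (sval x) + wt_eval nu (sval y).
  by move=> ->; apply: wt_evalD.
have hZ a (x z : elt borel) : sval z = a *: sval x ->
  wt_eval nu (sval z) = idfun a * wt_eval nu (sval x).
  by move=> ->; apply: wt_evalZ.
have hB (p q : bool) (x y z : elt borel) :
  homog p (sval x) -> homog q (sval y) ->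
  sval z = sbracket p q (sval x) (sval y) ->
  wt_eval nu (sval x) * wt_eval nu (sval y) =
  idfun ((-1) ^+ (p && q)) * (wt_eval nu (sval y) * wt_eval nu (sval x))
    + wt_eval nu (sval z).
  by move=> hx hy ->; apply: wt_evalB => //; [exact: (svalP x) | exact: (svalP y)].
by split; [apply: (ulift_is_zmod hC hD hZ hB) | apply: (ulift_is_monoid hC hD hZ hB)].
Qed.

HB.instance Definition _ nu :=
  GRing.isZmodMorphism.Build (U borel) F (bchar nu) (bchar_is_rmorphism nu).1.
HB.instance Definition _ nu :=
  GRing.isMonoidMorphism.Build (U borel) F (bchar nu) (bchar_is_rmorphism nu).2.

Definition one_dim (nu : 'rV[F]_n) : Type := F.
HB.instance Definition _ nu := GRing.Zmodule.on (one_dim nu).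

Section OneDim.
Variable nu : 'rV[F]_n.
Definition one_dim_scale (u : U borel) (z : one_dim nu) : one_dim nu :=
  bchar nu u * (z : F).

Lemma one_dim_scaleA u v z :
  one_dim_scale u (one_dim_scale v z) = one_dim_scale (u * v) z.
Proof. by rewrite /one_dim_scale rmorphM mulrA. Qed.
Lemma one_dim_scale1 : left_id 1 one_dim_scale.
Proof. by move=> z; rewrite /one_dim_scale rmorph1 mul1r. Qed.
Lemma one_dim_scaleDr : right_distributive one_dim_scale +%R.
Proof. by move=> u y z; apply: mulrDr. Qed.
Lemma one_dim_scaleDl z : {morph one_dim_scale^~ z : u v / u + v}.
Proof. by move=> u v; rewrite /one_dim_scale rmorphD; apply: mulrDl. Qed.

HB.instance Definition _ := GRing.Zmodule_isLmodule.Build (U borel) (one_dim nu)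
  one_dim_scaleA one_dim_scale1 one_dim_scaleDr one_dim_scaleDl.

Definition verma := tensor (@uincl _ _ _ borel pe borel_pe) (one_dim nu).
HB.instance Definition _ := GRing.Lmodule.on verma.
End OneDim.
End Periplectic.

Arguments pe F n : clear implicits.

Section Character.
Variables (F : fieldType) (n : nat) (M : lmodType (U (pe F n))).

Definition weight_space (nu : 'rV[F]_n) : set M :=
  [set v | forall h : elt (pe F n), is_diag_mx (sval h) ->
     ugen h *: v = ucst _ (wt_eval nu (sval h)) *: v]%classic.

(* Meaningful for V a linear subspace. *)
Definition has_dim (V : set M) (d : nat) : Prop :=
  exists b : 'I_d -> M, (forall i, V (b i)) /\
    forall v, V v -> exists! c : 'rV[F]_d, v = \sum_i ucst _ (c 0 i) *: b i.

(* 0 if V is infinite dimensional *)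
Definition dim (V : set M) : nat := xget 0%N [set d | has_dim V d]%classic.

Definition weight_module_fin : Prop :=
  (forall v : M, exists s : seq M, v = \sum_(x <- s) x /\
     forall x, x \in s -> exists nu, weight_space nu x) /\
  (forall nu, exists d, has_dim (weight_space nu) d).

(* The coefficient of e^nu; meaningful when weight_module_fin holds. *)
Definition ch (nu : 'rV[F]_n) : int := (dim (weight_space nu))%:Z.
End Character.

Definition fexp (F : fieldType) (n : nat) (mu nu : 'rV[F]_n) : int := (nu == mu)%:R.

Section DotAction.
Variable F : fieldType.
Implicit Types mu : 'rV[F]_2.

Definition eps (i : 'I_2) : 'rV[F]_2 := delta_mx 0 i.
Definition rho0 : 'rV[F]_2 := 2^-1 *: (eps 0 - eps 1).
Definition srefl mu : 'rV[F]_2 := xcol 0 1 mu.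
Definition sdot mu := srefl (mu + rho0) - rho0.

Lemma sdotE mu : (2 : F) != 0 ->
  sdot mu = (mu 0 1 - 1) *: eps 0 + (mu 0 0 + 1) *: eps 1.
Proof.
move=> two0; have half2 : 2^-1 + 2^-1 = 1 :> F.
  by rewrite -[LHS]mulr2n -[LHS]mulr_natr mulVf.
apply/rowP => j; rewrite /sdot /srefl /rho0 /eps.
have [->|->] : j = 0 \/ j = 1.
  by case: j => [[|[|//]] ltj]; [left|right]; apply: val_inj.
- rewrite !mxE tpermL !eqxx /= !(mulr0, mulr1, subr0, addr0, sub0r).
  by rewrite mulrN1 -addrA -opprD half2.
- rewrite !mxE tpermR !eqxx /= !(mulr0, mulr1, subr0, add0r, sub0r).
  by rewrite mulrN1 opprK -addrA half2.
Qed.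
End DotAction.

Section SimpleQuotient.
Variables (A : pzRingType) (M L : lmodType A).

Definition simple_quotient (p : {linear M -> L}) : Prop :=
  simple_module L /\ forall y, exists x, p x = y.
End SimpleQuotient.

(* Main.v *)
From HB Require Import structures.
Require Import Defs.
From mathcomp Require Import all_boot all_order all_algebra.
From mathcomp Require Import boolp classical_sets.
From mathcomp Require Import complex reals.
From mathcomp Require Import zify ring.

Set Implicit Arguments.
Unset Strict Implicit.
Unset Printing Implicit Defensive.

Import GRing.Theory.
Local Open Scope ring_scope.

(* The odd part g_(-1) is spanned by one element c; it satisfies c^2 = 0, commutes
   with sl(2), and [b, c] lies in sl(2) for every b in g_1. Hence M_mu has basis
   f^i v, c f^i v, and as an sl(2)-module it is two copies of the Verma module of
   highest weight lambda = mu_1 - mu_2, where g_1 kills the f^i v and sends c x to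
   [b, c] x. In a simple quotient with highest weight vector w:
   - e f^(i+1) w = (i+1)(lambda - i) f^i w, the same holds after applying c, and
     some b in g_1 gives b c w = - lambda w; this shows which basis vectors survive;
   - a highest weight vector whose Verma module does not contain the weight mu
     vanishes, since otherwise it would generate w. This kills f^(k+1) w if
     lambda = k, and then also c w if lambda = 0.
   All weights of M_mu have multiplicity one, so the characters can be read off. *)

(** * Sums and matrices of size two *)

Lemma ord2P (i : 'I_2) : i = 0 \/ i = 1.
Proof. by case: i => [[|[|//]] lti]; [left|right]; apply: val_inj. Qed.

Lemma sum2E (R : nmodType) (f : 'I_2 -> R) : \sum_i f i = f 0 + f 1.
Proof.
rewrite !big_ord_recl big_ord0 addr0.
by have -> : lift ord0 ord0 = 1 :> 'I_2 by apply: val_inj.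
Qed.

Lemma matrix2P (R : Type) (a b : 'M[R]_2) :
  a 0 0 = b 0 0 -> a 0 1 = b 0 1 -> a 1 0 = b 1 0 -> a 1 1 = b 1 1 -> a = b.
Proof.
move=> e00 e01 e10 e11; apply/matrixP => i j.
by case: (ord2P i) => ->; case: (ord2P j) => ->.
Qed.

(** * The Verma module on pairs of polynomials *)

Section Model.
Variables (F : fieldType) (nu : 'rV[F]_2).
Implicit Types (a b c : 'M[F]_2) (P Q : {poly F}).

(* The action of gl(2) on its Verma module of highest weight nu, the polynomial P
   standing for P(f) v: thus f acts as 'X, e_11 as nu_1 - 'X d/d'X, and so on. *)
Definition gl_op a P : {poly F} :=
  (a 0 0 * nu 0 0 + a 1 1 * nu 0 1) *: P + a 1 0 *: ('X * P)
  + (a 1 1 - a 0 0) *: ('X * P^`())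
  + a 0 1 *: ((nu 0 0 - nu 0 1) *: P^`() - 'X * P^`()^`()).

Lemma gl_op_is_linear a : linear (gl_op a).
Proof.
move=> k P Q; rewrite /gl_op !(derivD, derivZ) -!mul_polyC !(rmorphD, rmorphB, rmorphM)
  /=.
by ring.
Qed.
HB.instance Definition _ a :=
  GRing.isLinear.Build F {poly F} {poly F} *:%R (gl_op a) (gl_op_is_linear a).

Lemma gl_opDl a a' P : gl_op (a + a') P = gl_op a P + gl_op a' P.
Proof.
rewrite /gl_op !mxE -!mul_polyC !(rmorphD, rmorphB, rmorphN, rmorphM) /=; ring.
Qed.

Lemma gl_opZl k a P : gl_op (k *: a) P = k *: gl_op a P.
Proof.
rewrite /gl_op !mxE -!mul_polyC !(rmorphD, rmorphB, rmorphN, rmorphM) /=; ring.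
Qed.

Lemma gl_op0l P : gl_op 0 P = 0.
Proof. by rewrite -(scale0r (0 : 'M_2)) gl_opZl scale0r. Qed.

(** By the Leibniz rule both sides become linear in the successive derivatives of P, with
    coefficients polynomial in 'X, the matrix entries and the coordinates of [nu]; [ring] then
    treats the derivatives as atoms. *)
Lemma gl_opBr a a' P : gl_op (a *m a' - a' *m a) P =
  gl_op a (gl_op a' P) - gl_op a' (gl_op a P).
Proof.
rewrite /gl_op !mxE !big_ord_recl !big_ord0 /=.
rewrite !(derivD, derivB, derivZ, derivM, derivX, derivC) -!mul_polyC.
rewrite !(rmorphD, rmorphB, rmorphN, rmorphM) /=.
rewrite !(derivD, derivN, derivM, derivX, derivC).
have -> : lift ord0 ord0 = 1 :> 'I_2 by apply: val_inj.
by ring.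
Qed.
End Model.

(** * The matrix J and the odd part as a gl(2)-module *)

Section Symplectic.
Variable F : fieldType.
Implicit Types (a c : 'M[F]_2).

(* Skew-symmetric c are multiples of this J, and [b, J] is the traceless
    matrix b J in gl(2). *)
Definition symp_mx : 'M[F]_2 := \matrix_(i, j) ((i < j)%N%:R - (j < i)%N%:R).

Lemma mulmx2E a c i j : (a *m c) i j = a i 0 * c 0 j + a i 1 * c 1 j.
Proof. by rewrite mxE sum2E. Qed.

Lemma mxtrace2 a : \tr a = a 0 0 + a 1 1.
Proof. by rewrite /mxtrace sum2E. Qed.

(** The infinitesimal form of g^T J g = det(g) J. *)
Lemma trmx_mul_symp_mx a : a^T *m symp_mx = \tr a *: symp_mx - symp_mx *m a.
Proof.
by apply: matrix2P; rewrite !(mulmx2E, mxE, mxtrace2) /=; ring.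
Qed.

Lemma skew_symp_mx c : (2 : F) != 0 -> c^T = - c -> c = c 0 1 *: symp_mx.
Proof.
move=> two0 /matrixP hc.
have diag0 i : c i i = 0.
  have := hc i i; rewrite !mxE => /eqP; rewrite -subr_eq0 opprK -mulr2n -mulr_natr.
  by rewrite mulf_eq0 (negPf two0) orbF => /eqP.
apply: matrix2P; rewrite ?diag0 !mxE /= ?diag0; try by ring.
by have := hc 0 1; rewrite !mxE => ->; ring.
Qed.

(** A symmetric matrix is trace-orthogonal to a skew-symmetric one; this places [g_1, g_(-1)] in
    sl(2). *)
Lemma mxtrace_sym_symp_mx b : b^T = b -> \tr (b *m symp_mx) = 0.
Proof.
move=> /matrixP /(_ 0 1); rewrite mxE => hb.
by rewrite mxtrace2 !mulmx2E !mxE hb /=; ring.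
Qed.

(** Since a b + b a^T is the action of a on g_1, the map b -> b J identifies g_1 with the adjoint
    module sl(2) twisted by the trace. *)
Lemma mulmx_sym_symp_mx a b :
  (a *m b + b *m a^T) *m symp_mx =
    a *m (b *m symp_mx) - b *m symp_mx *m a + \tr a *: (b *m symp_mx).
Proof.
rewrite mulmxDl -!mulmxA trmx_mul_symp_mx mulmxBr -scalemxAr !mulmxA.
by rewrite -addrA [X in _ + X]addrC.
Qed.

(** Up to sign this is the bracket of a with g J: gl(2) acts on g_(-1) by minus the trace, whence
    the trace term in [pe_op]. *)
Lemma trmx_skew_symp_mx a (g : F) :
  a^T *m (g *: symp_mx) + g *: symp_mx *m a = (g * \tr a) *: symp_mx.
Proof.
by rewrite -scalemxAr -scalemxAl -scalerDr trmx_mul_symp_mx subrK scalerA.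
Qed.

End Symplectic.

(** * The action of pe(2) on pairs of polynomials *)

Section Action.
Variables (F : fieldType) (nu : 'rV[F]_2).
Hypothesis two0 : (2 : F) != 0.
Implicit Types (x y : 'M[F]_(2 + 2)) (v : {poly F} * {poly F}).

(* (P, Q) stands for P(f) v + c Q(f) v, with c the element of g_(-1) given by J. *)
Definition pe_op x v : {poly F} * {poly F} :=
  (gl_op nu (ulsubmx x) v.1 + gl_op nu (ursubmx x *m symp_mx F) v.2,
   gl_op nu (ulsubmx x) v.2 - \tr (ulsubmx x) *: v.2 + dlsubmx x 0 1 *: v.1).

Lemma pe_op_is_linearl v : linear (pe_op^~ v).
Proof.
move=> k x y.
have ulD : ulsubmx (k *: x + y) = k *: ulsubmx x + ulsubmx y.
  by apply/matrixP => i j; rewrite !mxE.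
have urD : ursubmx (k *: x + y) = k *: ursubmx x + ursubmx y.
  by apply/matrixP => i j; rewrite !mxE.
have dlD : dlsubmx (k *: x + y) 0 1 = k * dlsubmx x 0 1 + dlsubmx y 0 1.
  by rewrite !mxE.
rewrite /pe_op ulD urD dlD mulmxDl -scalemxAl !gl_opDl !gl_opZl mxtraceD mxtraceZ.
by apply: injective_projections; rewrite /= -!mul_polyC ?(rmorphD, rmorphM) /=; ring.
Qed.

Lemma pe_op_is_linear x : linear (pe_op x).
Proof.
move=> k [P Q] [P' Q']; rewrite /pe_op /= !linearP /=.
by apply: injective_projections; rewrite /= -!mul_polyC; ring.
Qed.
HB.instance Definition _ x :=
  GRing.isLinear.Build F ({poly F} * {poly F})%type ({poly F} * {poly F})%type
    *:%R (pe_op x) (pe_op_is_linear x).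

Lemma gl_opDr a P Q : gl_op nu a (P + Q) = gl_op nu a P + gl_op nu a Q.
Proof. exact: linearD. Qed.

Lemma gl_opNr a P : gl_op nu a (- P) = - gl_op nu a P.
Proof. exact: linearN. Qed.

Lemma gl_opZr a k P : gl_op nu a (k *: P) = k *: gl_op nu a P.
Proof. exact: linearZ. Qed.

Lemma gl_op0r a : gl_op nu a 0 = 0.
Proof. exact: linear0. Qed.

Lemma gl_opNl a P : gl_op nu (- a) P = - gl_op nu a P.
Proof. by rewrite -scaleN1r gl_opZl scaleN1r. Qed.

Lemma scale_symp_mx01 k : (k *: symp_mx F) 0 1 = k.
Proof. by rewrite !mxE subr0 mulr1. Qed.

Local Ltac simp := rewrite ?(trmx0, oppr0, mulmx0, mul0mx, addr0, add0r, subr0,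
  sub0r, opprK, mxtrace0, gl_op0l, gl_op0r, scale0r, scaler0, mulNmx, mulmxN, mul0r,
  mulr0, scale_symp_mx01).

(** One case for each pair of parities. Two odd elements bracket to some b J, which is traceless, so
    the trace term of [pe_op] contributes nothing. For mixed parities the twist by the trace on g_1
    matches the trace term on the second component. The even case is [gl_opBr]. *)
Lemma pe_op_bracket (p q : bool) x y v : x \in @in_pe F 2 -> y \in @in_pe F 2 ->
  homog p x -> homog q y ->
  pe_op x (pe_op y v)
  = (-1) ^+ (p && q) *: pe_op y (pe_op x v) + pe_op (sbracket p q x y) v.
Proof.
move=> /in_peP[a [b [c [hb /(skew_symp_mx two0)-> ->]]]].
move=> /in_peP[a' [b' [c' [hb' /(skew_symp_mx two0)-> ->]]]].
rewrite !homog_block sbracket_block; move: (c 0 1) (c' 0 1) => {c c'} g g' hp hq.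
case: v => P Q; rewrite /pe_op !(block_mxKul, block_mxKur, block_mxKdl).
case: p hp => /andP[/eqP h1 h2]; case: q hq => /andP[/eqP h3 h4];
 rewrite /= ?expr1 ?expr0 ?scaleN1r ?scale1r; subst.
- simp; rewrite -!scalemxAr !gl_opDl !gl_opZl !gl_opZr mxtraceD !mxtraceZ
    !mxtrace_sym_symp_mx //.
  simp; rewrite [X in X *: P]mxE; simp.
  by apply: injective_projections; rewrite /= -!mul_polyC; ring.
(* The lower left block g' J of an even element is zero by [h4]; its entry at (0, 1) gives g' =
   0. *)
- have e := scale_symp_mx01 g'; rewrite (eqP h4) mxE in e; subst g'; clear h2 h4; simp.
  have -> : - (b *m a'^T) - a' *m b = - (a' *m b + b *m a'^T) by rewrite opprD addrC.
  rewrite mulNmx gl_opNl mulmx_sym_symp_mx gl_opDl gl_opZl gl_opBr gl_opDr gl_opNr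
    !gl_opZr.
  rewrite [g *: _ *m a' + _]addrC trmx_skew_symp_mx scale_symp_mx01.
  by apply: injective_projections; rewrite /= -!mul_polyC ?(rmorphN, rmorphM) /=; ring.
- have e := scale_symp_mx01 g; rewrite (eqP h2) mxE in e; subst g; clear h2 h4; simp.
  have -> : - (a^T *m (g' *: symp_mx F)) - g' *: symp_mx F *m a =
    - (g' * \tr a) *: symp_mx F.
    by rewrite -opprD trmx_skew_symp_mx scaleNr.
  rewrite mulmx_sym_symp_mx gl_opDl gl_opZl scale_symp_mx01.
  rewrite gl_opBr gl_opDr gl_opNr !gl_opZr.
  by apply: injective_projections; rewrite /= -!mul_polyC ?(rmorphN, rmorphM) /=; ring.
- have e := scale_symp_mx01 g'; rewrite (eqP h4) mxE in e; subst g'; clear h4.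
  have e := scale_symp_mx01 g; rewrite (eqP h2) mxE in e; subst g; clear h2; simp.
  have -> : \tr (a *m a' - a' *m a) = 0 by rewrite raddfB /= mxtrace_mulC subrr.
  rewrite [X in X *: P]mxE !gl_opBr !gl_opDr !gl_opNr !gl_opZr; simp.
  by apply: injective_projections; rewrite /= -!mul_polyC; ring.
Qed.
End Action.

(** * Linear independence in the Verma module *)

Lemma uincl_pi (F : fieldType) (m n : nat) (S T : subsuperalgebra F m n)
    (sST : forall x, x \in carrier S -> x \in carrier T) (t : uterm S) :
  uincl sST (upi t) = ueval (@ucst _ _ _ T) (fun x => ugen (elt_incl sST x)) t.
Proof.
apply: ulift_pi => [a u|x y z|a x z|p q x y z]; first exact: ucstC.
- by move=> e; apply: ugenD.
- by move=> e; apply: ugenZ.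
- exact: (@ugenB _ _ _ T p q (elt_incl sST x) (elt_incl sST y) (elt_incl sST z)).
Qed.

Lemma bchar_pi (F : fieldType) (n : nat) (nu : 'rV[F]_n) (t : uterm (borel F n)) :
  bchar nu (upi t)
  = ueval (@idfun F) (fun x : elt (borel F n) => wt_eval nu (sval x)) t.
Proof.
apply: ulift_pi => [a x|x y z ->|a x z ->|p q x y z hx hy ->].
- by rewrite mulrC.
- exact: wt_evalD.
- exact: wt_evalZ.
- by apply: wt_evalB => //; [exact: (svalP x) | exact: (svalP y)].
Qed.

Local Notation borel_incl F := (@uincl _ _ _ (borel F 2) (pe F 2) (@borel_pe F 2)).

Section VermaModel.
Variables (F : fieldType) (nu : 'rV[F]_2).
Hypothesis two0 : (2 : F) != 0.
Let V : Type := ({poly F} * {poly F})%type.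

(** Defined on terms, because [ulift] would ask for a ring of endomorphisms as its target;
    [act_equiv] passes to the quotient. *)
Fixpoint act (t : uterm (pe F 2)) (v : V) : V :=
  match t with
  | UGen x => pe_op nu (sval x) v
  | UCst a => a *: v
  | UAdd t u => act t v + act u v
  | UMul t u => act t (act u v)
  end.

Lemma act_linear t : linear (act t).
Proof.
elim: t => [x|a|t IHt u IHu|t IHt u IHu] k v w /=.
- exact: linearP.
- by rewrite scalerDr !scalerA mulrC.
- by rewrite IHt IHu scalerDr addrACA.
- by rewrite IHu IHt.
Qed.

Lemma actD t : {morph act t : v w / v + w}.
Proof. by move=> v w; rewrite -[v]scale1r act_linear !scale1r. Qed.

Lemma act0 t : act t 0 = 0.
Proof. by apply: (addIr (act t 0)); rewrite -actD !add0r. Qed.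

Lemma actZ t a v : act t (a *: v) = a *: act t v.
Proof. by rewrite -[a *: v]addr0 act_linear act0 addr0. Qed.

(** The content is in [ue_genB], which is [pe_op_bracket]; the other relations are module laws and
    linearity of [act] and [pe_op]. *)
Lemma act_equiv t u : uequiv t u -> act t =1 act u.
Proof.
elim=> {t u} /=.
- by [].
- by move=> t u _ tu v; rewrite tu.
- by move=> t u v _ tu _ uv w; rewrite tu uv.
- by move=> t t' u u' _ tt' _ uu' v; rewrite tt' uu'.
- by move=> t t' u u' _ tt' _ uu' v; rewrite tt' uu'.
- by move=> *; move=> ?; rewrite addrA.
- by move=> *; move=> ?; rewrite addrC.
- by move=> t v; rewrite scale0r add0r.
- by [].
- by move=> t v; rewrite scale1r.
- by move=> t v; rewrite !scale0r.
- by [].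
- by move=> t u v w; rewrite actD.
- by move=> a b v; rewrite scalerDl.
- by move=> a b v; rewrite scalerA.
- by move=> a t v; rewrite actZ.
- by move=> x y z -> v; rewrite -[sval x]scale1r pe_op_is_linearl !scale1r.
- by move=> a x z -> v; rewrite (scalable_linear (pe_op_is_linearl nu v)).
- move=> p q x y z hp hq -> v.
  by rewrite (pe_op_bracket nu two0 v (svalP x) (svalP y) hp hq).
Qed.

Definition actU (u : U (pe F 2)) : V -> V := act (urepr u).

Lemma actU_pi t : actU (upi t) =1 act t.
Proof. exact/act_equiv/urepr_pi. Qed.

Lemma actUD u u' v : actU (u + u') v = actU u v + actU u' v.
Proof.
have [t ->] := upi_surj u; have [t' ->] := upi_surj u'.
by rewrite -[upi t + _]upi_add !actU_pi.
Qed.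

Lemma actUM u u' v : actU (u * u') v = actU u (actU u' v).
Proof.
have [t ->] := upi_surj u; have [t' ->] := upi_surj u'.
by rewrite -[upi t * _]upi_mul !actU_pi.
Qed.

Let v0 : V := (1, 0).

(** The derivatives of 1 vanish and an upper triangular a has no f-term, so (1, 0) is a highest
    weight vector of the model. This gives the balancedness relation in [verma_eval_equiv]. *)
Lemma actU_borel (u : U (borel F 2)) :
  actU (borel_incl F u) v0 = bchar nu u *: v0.
Proof.
have [t ->] := upi_surj u; rewrite uincl_pi bchar_pi.
elim: t => [x|a|t IHt u' IHu|t IHt u' IHu] /=.
- rewrite actU_pi /=; have /in_borelP[a [b [/is_trig_mxP ha hb ->]]] := svalP x.
  have a10 : a 1 0 = 0 by have := ha 0 1 isT; rewrite mxE.
  rewrite /pe_op /wt_eval sum2E !(block_mxKul, block_mxKur, block_mxKdl) mxE.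
  apply: injective_projections => /=; last first.
    by rewrite (gl_op0r nu a) !scaler0 scale0r oppr0 !addr0.
  rewrite (gl_op0r nu) addr0 /gl_op a10 !(derivC, deriv0, mulr0, scaler0, subr0,
    scale0r, addr0).
  by congr (_ *: _); rewrite ![nu _ _ * _]mulrC.
- by rewrite actU_pi.
- by rewrite actUD IHt IHu scalerDl.
- by rewrite actUM IHu /actU actZ -/(actU _ _) IHt scalerA mulrC.
Qed.

Fixpoint verma_eval (t : tterm (U (pe F 2)) (one_dim nu)) : V :=
  match t with
  | TPure b n => (n : F) *: actU b v0
  | TZero => 0
  | TOpp t => - verma_eval t
  | TAdd t u => verma_eval t + verma_eval u
  end.

Lemma verma_eval_equiv t u : tequiv (borel_incl F) t u -> verma_eval t = verma_eval u.
Proof.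
elim=> {t u} /=; try by move=> *; congruence.
- by move=> *; rewrite addrA.
- by move=> *; rewrite addrC.
- by move=> *; rewrite add0r.
- by move=> *; rewrite addNr.
- by move=> b b' n; rewrite actUD scalerDr.
- by move=> b n n'; rewrite scalerDl.
- move=> b a n; rewrite actUM actU_borel /actU actZ scalerA.
  by congr (_ *: _); rewrite mulrC.
Qed.

(* Only used to separate basis vectors of M_nu, so linearity is never needed. *)
Definition verma_coord (z : verma nu) : V := verma_eval (trepr z).

Lemma verma_coord_pure u :
  verma_coord (pure (borel_incl F) u ((1 : F) : one_dim nu)) = actU u v0.
Proof.
by rewrite /verma_coord (verma_eval_equiv (trepr_pi _ _)) /= scale1r.
Qed.

End VermaModel.

(** * Highest weight vectors *)

Section HighestWeight.
Variables (F : fieldType) (M : lmodType (U (pe F 2))).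
Hypothesis two0 : (2 : F) != 0.
Implicit Types (a b : 'M[F]_2) (P Q : {poly F}) (x : elt (pe F 2)).

Lemma scale_ucstC (u : U (pe F 2)) k (m : M) :
  u *: (ucst _ k *: m) = ucst _ k *: (u *: m).
Proof. by rewrite !scalerA ucstC. Qed.

Definition pe_elt y (hy : y \in carrier (pe F 2)) : elt (pe F 2) := exist _ y hy.

Lemma pe_even_subproof a : block_mx a 0 0 (- a^T) \in carrier (pe F 2).
Proof. by apply/in_peP; exists a, 0, 0; rewrite trmx0 oppr0. Qed.
Definition pe_even a : elt (pe F 2) := pe_elt (pe_even_subproof a).

Lemma pe_c_subproof : block_mx 0 0 (symp_mx F) 0 \in carrier (pe F 2).
Proof.
apply/in_peP; exists 0, 0, (symp_mx F); rewrite trmx0 oppr0; split=> //.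
by apply: matrix2P; rewrite !mxE /=; ring.
Qed.
Definition pe_c : elt (pe F 2) := pe_elt pe_c_subproof.
Definition pe_f : elt (pe F 2) := pe_even (delta_mx 1 0).

Lemma ugen_bracket (p q : bool) x y z : homog p (sval x) -> homog q (sval y) ->
  sval z = sbracket p q (sval x) (sval y) -> forall m : M,
  ugen x *: (ugen y *: m) = ucst _ ((-1) ^+ (p && q)) *: (ugen y *: (ugen x *: m)) +
    ugen z *: m.
Proof.
by move=> hx hy hz m; rewrite scalerA (ugenB hx hy hz) scalerDl -!scalerA.
Qed.

Lemma ugenP k x y z : sval z = k *: sval x + sval y -> forall m : M,
  ugen z *: m = ucst _ k *: (ugen x *: m) + ugen y *: m.
Proof.
move=> hz m; have kx_pe : k *: sval x \in carrier (pe F 2).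
  have [in0 inP] := carrier_submod (pe F 2).
  by rewrite -[_ *: _]addr0 inP //; apply: (svalP x).
rewrite (@ugenD _ _ _ _ (pe_elt kx_pe) y) // (@ugenZ _ _ _ _ k x) //.
by rewrite scalerDl scalerA.
Qed.

Lemma ugen_eq0 x (m : M) : sval x = 0 -> ugen x *: m = 0.
Proof.
move=> hx; rewrite (@ugenZ _ _ _ _ 0 x x); last by rewrite hx scaler0.
by rewrite rmorph0 mul0r scale0r.
Qed.

Lemma homog_pe_even a : homog false (sval (pe_even a)).
Proof. by rewrite [sval _]/= homog_block !eqxx. Qed.

Lemma homog_pe_c : homog true (sval pe_c).
Proof. by rewrite [sval _]/= homog_block !eqxx. Qed.

Lemma pe_even_bracket a a' (m : M) : ugen (pe_even a) *: (ugen (pe_even a') *: m) =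
  ugen (pe_even a') *: (ugen (pe_even a) *: m) +
    ugen (pe_even (a *m a' - a' *m a)) *: m.
Proof.
rewrite (@ugen_bracket false false _ _ (pe_even (a *m a' - a' *m a))) ?homog_pe_even //.
  by rewrite /= rmorph1 scale1r.
rewrite sbracket_block /= expr0 !scale1r !(mulmx0, mul0mx, addr0, add0r, subr0, mulmxN,
  mulNmx, opprK).
by rewrite oppr0 linearB /= !trmx_mul opprB.
Qed.

(** The relation [c, c] = 0 reads c^2 = - c^2, and 2 is invertible. *)
Lemma pe_c_sqr (m : M) : ugen pe_c *: (ugen pe_c *: m) = 0.
Proof.
have z_pe : (0 : 'M[F]_(2 + 2)) \in carrier (pe F 2) by case: (carrier_submod (pe F 2)).
have hz : 0 = sbracket true true (sval pe_c) (sval pe_c).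
  by rewrite sbracket_block /= !(mulmx0, mul0mx, addr0, scaler0, subr0, block_mx0).
have := @ugen_bracket true true pe_c pe_c (pe_elt z_pe) homog_pe_c homog_pe_c hz m.
rewrite expr1 rmorphN1 scaleN1r [X in _ + X]ugen_eq0 // addr0 => /eqP.
rewrite -addr_eq0 -mulr2n -[_ *+ 2]scaler_nat => /eqP /(congr1 (fun y =>
  ucst _ 2^-1 *: y)).
rewrite scaler0 => <-.
by rewrite -(rmorph_nat (ucst (pe F 2))) [RHS]scalerA -(rmorphM (ucst (pe F 2))) mulVf
  // rmorph1 scale1r.
Qed.

Lemma pe_even_pe_c a (m : M) : ugen (pe_even a) *: (ugen pe_c *: m) =
  ugen pe_c *: (ugen (pe_even a) *: m) - ucst _ (\tr a) *: (ugen pe_c *: m).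
Proof.
have z_pe : - \tr a *: sval pe_c \in carrier (pe F 2).
  have [in0 inP] := carrier_submod (pe F 2).
  by rewrite -[_ *: _]addr0 inP //; apply: (svalP pe_c).
rewrite (@ugen_bracket false true _ _ (pe_elt z_pe)) ?homog_pe_even ?homog_pe_c //.
  rewrite /= rmorph1 scale1r; congr (_ + _).
  by rewrite (@ugenZ _ _ _ _ (- \tr a) pe_c) // rmorphN -scalerA scaleNr.
rewrite /= sbracket_block /= expr0 !(scale1r, mulmx0, mul0mx, addr0, add0r, subr0,
  mulmxN, mulNmx, opprK, oppr0).
rewrite scale_block_mx !scaler0; congr block_mx.
by rewrite trmx_mul_symp_mx opprB addrAC addrN add0r scaleNr.
Qed.

Lemma pe_symP x a b c d : sval x = block_mx a b c d -> b^T = b.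
Proof.
move=> hx; have /in_peP[a' [b' [c' [hb' _ e]]]] := svalP x.
by move: e; rewrite hx => /eq_block_mx[_ -> _ _].
Qed.

(** The lower right block of the bracket is J b, and J b = - (b J)^T because b is symmetric and J
    skew-symmetric. *)
Lemma sym_c x b (m : M) : sval x = block_mx 0 b 0 0 ->
  ugen x *: (ugen pe_c *: m) =
  - (ugen pe_c *: (ugen x *: m)) + ugen (pe_even (b *m symp_mx F)) *: m.
Proof.
move=> hx; have hb := pe_symP hx.
rewrite (@ugen_bracket true true _ _ (pe_even (b *m symp_mx F))) ?homog_pe_c ?hx
  ?homog_block ?eqxx //.
  by rewrite expr1 rmorphN1 scaleN1r.
rewrite /= sbracket_block /= expr1 !(scaleN1r, mulmx0, mul0mx, addr0, add0r, subr0,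
  mulmxN, mulNmx, opprK, oppr0).
congr block_mx; apply: matrix2P; move/matrixP/(_ 0 1): hb;
  rewrite mxE !(mulmx2E, mxE) /= => ->; ring.
Qed.

End HighestWeight.

(** This covers the nilradical too: [wt_eval] reads only the diagonal of the upper left block, so
    strictly upper triangular a and all of g_1 kill w. Zero is allowed, so that singular vectors can
    be treated before they are known to vanish. *)
Definition highest_weight (F : fieldType) (n : nat) (M : lmodType (U (pe F n)))
    (nu : 'rV[F]_n) (w : M) : Prop :=
  forall x : elt (pe F n), sval x \in @in_borel F n ->
  ugen x *: w = ucst _ (wt_eval nu (sval x)) *: w.

Section Phi.
Variables (F : fieldType) (M : lmodType (U (pe F 2))) (nu : 'rV[F]_2) (w : M).
Hypothesis two0 : (2 : F) != 0.
Implicit Types (a b : 'M[F]_2) (P Q : {poly F}) (x : elt (pe F 2)).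

(* P(f) w *)
Definition hw_map1 P : M :=
  \sum_(i < size P) ucst _ P`_i *: (ugen (pe_f F) ^+ i *: w).

Lemma hw_map1_widen k P : (size P <= k)%N ->
  hw_map1 P = \sum_(i < k) ucst _ P`_i *: (ugen (pe_f F) ^+ i *: w).
Proof.
move=> le_P_k; rewrite /hw_map1.
pose f i := ucst (pe F 2) P`_i *: (ugen (pe_f F) ^+ i *: w).
rewrite -(big_mkord xpredT f) (big_nat_widen _ _ k) // big_mkord.
rewrite [RHS](bigID (fun i : 'I_k => (i < size P)%N)) /= [X in _ = _ + X]big1 ?addr0 //.
move=> i; rewrite -leqNgt => /(nth_default 0) ->.
by rewrite rmorph0 scale0r.
Qed.

Lemma hw_map1P k P Q : hw_map1 (k *: P + Q) = ucst _ k *: hw_map1 P + hw_map1 Q.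
Proof.
set n := maxn (size (k *: P + Q)) (maxn (size P) (size Q)).
rewrite !(@hw_map1_widen n) /n ?leq_max ?leqnn ?orbT // scaler_sumr -big_split.
apply: eq_bigr => i _ /=.
by rewrite coefD coefZ rmorphD rmorphM scalerDl !scalerA.
Qed.

Lemma hw_map1_0 : hw_map1 0 = 0.
Proof. by rewrite /hw_map1 size_poly0 big_ord0. Qed.

Lemma hw_map1D P Q : hw_map1 (P + Q) = hw_map1 P + hw_map1 Q.
Proof. by rewrite -[P]scale1r hw_map1P rmorph1 !scale1r. Qed.

Lemma hw_map1Z k P : hw_map1 (k *: P) = ucst _ k *: hw_map1 P.
Proof. by rewrite -[k *: P]addr0 hw_map1P hw_map1_0 addr0. Qed.

Lemma hw_map1_1 : hw_map1 1 = w.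
Proof. by rewrite /hw_map1 size_poly1 big_ord1 coef1 rmorph1 expr0 !scale1r. Qed.

Lemma hw_map1X P : hw_map1 ('X * P) = ugen (pe_f F) *: hw_map1 P.
Proof.
have [-> | nzP] := eqVneq P 0; first by rewrite mulr0 hw_map1_0 scaler0.
rewrite (@hw_map1_widen (size P).+1); last by rewrite mulrC size_mulX.
rewrite big_ord_recl coefXM /= rmorph0 scale0r add0r scaler_sumr.
apply: eq_bigr => i _; rewrite coefXM /= scale_ucstC; congr (_ *: _).
by rewrite scalerA -exprS.
Qed.

(** Mirrors how the vectors P(f) w arise: start at w, apply f, take linear combinations. *)
Lemma poly_mulX_ind (K : {poly F} -> Prop) :
  K 1 -> (forall P, K P -> K ('X * P)) ->
  (forall k P Q, K P -> K Q -> K (k *: P + Q)) -> forall P, K P.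
Proof.
move=> K1 KX KP; have K0 : K 0 by rewrite -(addNr 1) -scaleN1r; apply: KP.
elim/poly_ind => // P c KPP; rewrite addrC -alg_polyC mulrC.
by apply: KP => //; apply: KX.
Qed.

Hypothesis hw : highest_weight nu w.

Lemma gl_op_f P : gl_op nu (delta_mx 1 0) P = 'X * P.
Proof. by rewrite /gl_op !mxE /= !(mul0r, add0r, subr0, oppr0, scale0r, addr0,
  scale1r). Qed.

Lemma gl_op1 a : gl_op nu a 1 = (a 0 0 * nu 0 0 + a 1 1 * nu 0 1) *: 1 + a 1 0 *: 'X.
Proof. by rewrite /gl_op !(derivC, deriv0, mulr0, scaler0, subr0, addr0, mulr1). Qed.

Lemma pe_even_hw a : ugen (pe_even a) *: w = hw_map1 (gl_op nu a 1).
Proof.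
(* Removing the f-component of a leaves an element of the Borel subalgebra, which acts on w by its
   weight. *)
pose a' := a - a 1 0 *: delta_mx 1 0.
have borel_a' : sval (pe_even a') \in @in_borel F 2.
  apply/in_borelP; exists a', 0; split=> //; last by rewrite trmx0.
  apply/is_trig_mxP => i j; case: (ord2P i) => ->; case: (ord2P j) => -> //= _.
  by rewrite !mxE !eqxx mulr1 subrr.
rewrite (@ugenP _ _ (a 1 0) (pe_f F) (pe_even a')) ?(hw borel_a'); last first.
  rewrite /= scale_block_mx add_block_mx /a' !scaler0 !addr0 addrC subrK.
  congr block_mx; rewrite linearB linearZ /=; set t := _ *: _^T.
  by rewrite opprB scalerN addKr.
rewrite gl_op1 hw_map1D !hw_map1Z -['X]mulr1 hw_map1X hw_map1_1 addrC; congr (_ + _).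
congr (ucst _ _ *: _); rewrite /wt_eval sum2E block_mxKul !mxE /=.
by rewrite !mulr0 !subr0 ![nu _ _ * _]mulrC.
Qed.

(** Induction for all a at once: moving a past f leaves [a, f], again in gl(2), and [gl_opBr] gives
    the same commutator in the model. *)
Lemma pe_even_hw_map1 a P : ugen (pe_even a) *: hw_map1 P = hw_map1 (gl_op nu a P).
Proof.
elim/poly_mulX_ind: P a => [|P IH|k P Q IHP IHQ] a.
- by rewrite hw_map1_1 pe_even_hw.
- rewrite hw_map1X pe_even_bracket !IH -hw_map1X -hw_map1D -!gl_op_f gl_opBr.
  by rewrite addrC subrK.
- by rewrite hw_map1P scalerDr scale_ucstC IHP IHQ linearP hw_map1P.
Qed.

(** Induction for all b at once: g_1 kills w, and [b, f] lies in g_1 again. *)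
Lemma sym_hw_map1 x b P : sval x = block_mx 0 b 0 0 -> ugen x *: hw_map1 P = 0.
Proof.
elim/poly_mulX_ind: P x b => [|P IH|k P Q IHP IHQ] x b hx.
- rewrite hw_map1_1 (hw (x := x)); last first.
    by apply/in_borelP; exists 0, b; rewrite hx trmx0 oppr0 mx0_is_trig (pe_symP hx).
  by rewrite hx /wt_eval block_mxKul big1 ?rmorph0 ?scale0r // => i _;
    rewrite mxE mulr0.
- have hom_x : homog true (sval x) by rewrite hx homog_block eqxx.
  have z_pe := pe_bracket (svalP x) (svalP (pe_f F)) hom_x (homog_pe_even _).
  rewrite hw_map1X (@ugen_bracket _ _ true false _ _ (pe_elt z_pe)) ?homog_pe_even //.
  rewrite (IH x b) // !scaler0 add0r.
  (* This matrix is the upper right block of [b, f]. *)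
  apply: (IH _ (b *m - (delta_mx 1 0)^T - delta_mx 1 0 *m b)).
  by rewrite /= hx sbracket_block /= !(scale1r, mulmx0, mul0mx, addr0, add0r, subr0,
    oppr0).
- by rewrite hw_map1P scalerDr scale_ucstC (IHP _ b) // (IHQ _ b) // scaler0 addr0.
Qed.

Definition hw_map (v : {poly F} * {poly F}) : M := hw_map1 v.1 +
  ugen (pe_c F) *: hw_map1 v.2.

Lemma hw_mapP k v v' : hw_map (k *: v + v') = ucst _ k *: hw_map v + hw_map v'.
Proof. by rewrite /hw_map /= !hw_map1P !scalerDr scale_ucstC addrACA. Qed.

Lemma hw_map0 : hw_map 0 = 0.
Proof. by rewrite /hw_map hw_map1_0 scaler0 addr0. Qed.

Lemma hw_mapZ k v : hw_map (k *: v) = ucst _ k *: hw_map v.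
Proof. by rewrite -[k *: v]addr0 hw_mapP hw_map0 addr0. Qed.

(** The universal property of the Verma module in coordinates. Split x into its parts in g_(-1), g_0
    and g_1. On c Q(f) w the first gives 0, the second commutes with c up to its trace, and the
    third acts as [b, c] on Q(f) w, because b kills Q(f) w. *)
Lemma hw_map_pe_op x v : ugen x *: hw_map v = hw_map (pe_op nu (sval x) v).
Proof.
case: v => P Q; have /in_peP[a [b [c [hb /(skew_symp_mx two0) hc hx]]]] := svalP x.
have b_pe : block_mx 0 b 0 0 \in carrier (pe F 2).
  by apply/in_peP; exists 0, b, 0; rewrite !trmx0 oppr0.
have ab_pe : block_mx a b 0 (- a^T) \in carrier (pe F 2).
  by apply/in_peP; exists a, b, 0; rewrite !trmx0 oppr0.
rewrite (@ugenP _ _ (c 0 1) (pe_c F) (pe_elt ab_pe)); last first.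
  by rewrite /= scale_block_mx add_block_mx !scaler0 !add0r addr0 -hc.
rewrite (@ugenP _ _ 1 (pe_even a) (pe_elt b_pe) (pe_elt ab_pe)); last first.
  by rewrite /= scale1r add_block_mx !addr0 !add0r.
rewrite rmorph1 scale1r /hw_map /pe_op hx !(block_mxKul, block_mxKur, block_mxKdl) /=.
rewrite !scalerDr pe_c_sqr // scaler0 addr0.
rewrite pe_even_hw_map1 pe_even_pe_c pe_even_hw_map1 (sym_hw_map1 _ (erefl :
  sval (pe_elt b_pe) = _)) add0r.
rewrite (@sym_c _ _ _ b) // (sym_hw_map1 _ (erefl : sval (pe_elt b_pe) = _)).
rewrite scaler0 oppr0 add0r pe_even_hw_map1.
move: (gl_op nu a P) (gl_op nu a Q) (gl_op nu (b *m symp_mx F) Q) => P' Q' Q''.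
rewrite !(hw_map1D, hw_map1Z) -[- (_ *: Q)]scaleNr hw_map1Z rmorphN scaleNr.
rewrite !scalerDr scalerN !scale_ucstC.
by rewrite addrC [hw_map1 P' + _ + hw_map1 Q'']addrAC -[LHS]addrA.
Qed.

(** With linearity this makes the image of [hw_map] a submodule, hence everything if w generates M
    or if M is simple and w nonzero. *)
Lemma hw_map_surj_sub (u : U (pe F 2)) v : exists v', u *: hw_map v = hw_map v'.
Proof.
have [t ->] := upi_surj u; elim: t v => [x|k|t IHt t' IHt'|t IHt t' IHt'] v.
- by exists (pe_op nu (sval x) v); rewrite -hw_map_pe_op.
- by exists (k *: v + 0); rewrite hw_mapP /hw_map /= hw_map1_0 scaler0 !addr0.
- have [v1 e1] := IHt v; have [v2 e2] := IHt' v; exists (1 *: v1 + v2).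
  by rewrite hw_mapP rmorph1 scale1r -e1 -e2 upi_add -scalerDl.
- have [v2 e2] := IHt' v; have [v1 e1] := IHt v2; exists v1.
  by rewrite -e1 -e2 upi_mul scalerA.
Qed.

End Phi.

(** * Weights and characters *)

Section Dimension.
Variables (F : fieldType) (n : nat) (M : lmodType (U (pe F n))).
Implicit Type V : set M.

(** The rows expressing b' through b are linearly independent, so there are at most d of them. *)
Lemma has_dim_le V d d' : V 0 -> has_dim V d -> has_dim V d' -> (d' <= d)%N.
Proof.
move=> V0 [b [Vb bP]] [b' [Vb' b'P]].
have /choice[A hA] : forall i, exists c : 'rV[F]_d, b' i = \sum_j ucst _ (c 0 j) *: b j.
  by move=> i; have [c [-> _]] := bP _ (Vb' i); exists c.
suff : row_free (\matrix_i A i) by move=> /eqP <-; apply: rank_leq_col.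
rewrite -kermx_eq0; apply/negPn/negP => /rowV0Pn[u /sub_kermxP uA /negP]; apply.
(* Uniqueness of coordinates is given only for members of V, hence the use of V 0: both 0 and u are
   coordinates of the zero vector. *)
have [c [_ cuniq]] := b'P _ V0; apply/eqP.
rewrite -(cuniq 0); last by rewrite big1 // => i _; rewrite mxE rmorph0 scale0r.
symmetry; apply: cuniq.
have {}uA j : \sum_i u 0 i * A i 0 j = 0.
  move/rowP: uA => /(_ j); rewrite !mxE => {2}<-.
  by apply: eq_bigr => i _; rewrite !mxE.
under eq_bigr => i _ do rewrite hA scaler_sumr.
rewrite exchange_big big1 //= => j _.
under eq_bigr => i _ do rewrite scalerA -rmorphM.
by rewrite -scaler_suml -rmorph_sum uA rmorph0 scale0r.
Qed.

Lemma dimE V d : V 0 -> has_dim V d -> Defs.dim V = d.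
Proof.
move=> V0 hd; rewrite /Defs.dim; case: xgetP => [d' _ hd'|/(_ d) //].
by apply/eqP; rewrite eqn_leq !(has_dim_le V0 _ hd, has_dim_le V0 hd).
Qed.

Lemma ucst_eq0 k (m : M) : k != 0 -> ucst _ k *: m = 0 -> m = 0.
Proof.
move=> nzk /(congr1 (fun y => ucst _ k^-1 *: y)).
by rewrite scaler0 scalerA -rmorphM mulVf // rmorph1 scale1r.
Qed.

Lemma has_dim0 V : V 0 -> (forall m, V m -> m = 0) -> has_dim V 0.
Proof.
move=> V0 Vm; exists (fun=> 0); split=> // m /Vm ->; exists 0.
by split=> [|c _]; [rewrite big_ord0 | apply/rowP; case].
Qed.

Lemma has_dim1 V w : V w -> w != 0 -> (forall m, V m -> exists k, m = ucst _ k *: w) ->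
  has_dim V 1.
Proof.
move=> Vw nzw Vm; exists (fun=> w); split=> // m /Vm[k ->]; exists (const_mx k).
split=> [|c]; first by rewrite big_ord1 mxE.
rewrite big_ord1 => /eqP; rewrite -subr_eq0 -scalerBl -rmorphB => /eqP kc.
apply/rowP => i; rewrite ord1 mxE; apply/eqP; rewrite -subr_eq0.
by apply: contraNT nzw => nz; apply/eqP; apply: (ucst_eq0 nz).
Qed.
End Dimension.

Section Weights.
Variables (F : fieldType) (M : lmodType (U (pe F 2))).
Implicit Types (nu : 'rV[F]_2).

Lemma weight_space0 nu : weight_space nu (0 : M).
Proof. by move=> h _; rewrite !scaler0. Qed.

Lemma weight_spaceP nu k (m m' : M) :
  weight_space nu m -> weight_space nu m' -> weight_space nu (ucst _ k *: m + m').
Proof. by move=> hm hm' h dh;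
  rewrite scalerDr scale_ucstC hm // hm' // scalerDr scale_ucstC. Qed.

Lemma weight_spaceZ nu k (m : M) : weight_space nu m -> weight_space nu (ucst _ k *: m).
Proof.
by move=> Wm; rewrite -[_ *: m]addr0; apply: weight_spaceP => //; apply: weight_space0.
Qed.

(** Vectors of distinct weights are independent. Applying h - wt(t0)(h) removes the term at t0 and
    rescales the others, so the induction hypothesis applies to the rescaled family. *)
Lemma weight_indep (T : eqType) (wt : T -> 'rV[F]_2) (s : seq T) nu (x : T ->
  M) (m : M) :
  uniq (map wt s) -> nu \notin map wt s ->
  weight_space nu m -> (forall t, t \in s -> weight_space (wt t) (x t)) ->
  m = \sum_(t <- s) x t -> m = 0 /\ forall t, t \in s -> x t = 0.
Proof.
elim: s x m => [|t0 s IH] x m /=; first by rewrite big_nil.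
case/andP=> t0s us; rewrite inE negb_or => /andP[nut0 nus] Wm Wx;
  rewrite big_cons => em.
have sep nu1 nu2 (y : M) : nu1 != nu2 ->
    (forall i, ucst _ (nu1 0 i - nu2 0 i) *: y = 0) -> y = 0.
  move=> ne hy; case: (pselect (exists i, nu1 0 i != nu2 0 i)) => [[i nei]|noi].
    by apply: ucst_eq0 (hy i); rewrite subr_eq0.
  case/eqP: ne; apply/rowP => i; apply/eqP; apply: contrapT => nei.
  by apply: noi; exists i; apply/negP.
(* Here h is e_ii, on which a weight takes its i-th coordinate as value. *)
have step i : ucst _ (nu 0 i - wt t0 0 i) *: m = 0 /\
    forall t, t \in s -> ucst _ (wt t 0 i - wt t0 0 i) *: x t = 0.
  have di : is_diag_mx (sval (pe_even (delta_mx i i : 'M[F]_2))).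
    rewrite /= is_diag_block_mx ?eqxx //=.
    have dd : is_diag_mx (delta_mx i i : 'M[F]_2).
      apply/is_diag_mxP => j k; rewrite mxE.
      by case: (j =P i) => //= ->; case: (k =P i) => //= ->; rewrite eqxx.
    by rewrite dd trmx_delta; apply/is_diag_mxP => j k jk; rewrite mxE;
      move/is_diag_mxP: dd => -> //; rewrite oppr0.
  have ev nu' : wt_eval nu' (sval (pe_even (delta_mx i i : 'M[F]_2))) = nu' 0 i.
    rewrite /wt_eval /= block_mxKul (bigD1 i) //= mxE !eqxx mulr1 big1 ?addr0 // =>
      j /negPf ji.
    by rewrite mxE ji mulr0.
  apply: (IH (fun t => ucst _ (wt t 0 i - wt t0 0 i) *: x t)) => //.
  - exact: weight_spaceZ.
  - by move=> t ts; apply/weight_spaceZ/Wx; rewrite inE ts orbT.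
  - have := Wm _ di; rewrite ev rmorphB scalerBl => <-.
    rewrite {1}em scalerDr (Wx t0 _ _ di) ?inE ?eqxx // ev em scalerDr opprD addrACA
      addrN add0r.
    rewrite !scaler_sumr -sumrB; apply: eq_big_seq => t ts.
    by rewrite (Wx t _ _ di) ?inE ?ts ?orbT // ev rmorphB scalerBl.
have m0 : m = 0 by apply: sep nut0 _ => i; have [] := step i.
have xs0 t : t \in s -> x t = 0.
  move=> ts; apply: (sep (wt t) (wt t0)) => [|i]; last by have [_ ->] := step i.
  by apply: contraNneq t0s => <-; apply: map_f.
split=> // t; rewrite inE => /predU1P[->|/xs0//].
by move: em; rewrite m0 big1_seq ?addr0 // => t' /= /xs0.
Qed.

(** The difference of the two sides has weight nu and is a sum of vectors of other distinct weights,
    so it is zero by [weight_indep]. *)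
Lemma weight_proj (T : eqType) (wt : T -> 'rV[F]_2) (s : seq T) nu (x : T ->
  M) (m : M) :
  uniq (map wt s) ->
  weight_space nu m -> (forall t, t \in s -> weight_space (wt t) (x t)) ->
  m = \sum_(t <- s) x t -> m = \sum_(t <- s | wt t == nu) x t.
Proof.
move=> us Wm Wx em; apply/eqP; rewrite -subr_eq0; apply/eqP.
pose s' := [seq t <- s | wt t != nu].
have ss' : subseq (map wt s') (map wt s) by apply/map_subseq/filter_subseq.
have Wsum : weight_space nu (\sum_(t <- s | wt t == nu) x t).
  rewrite big_seq_cond; elim/big_ind: _ => [|m1 m2 W1 W2|t /andP[ts /eqP <-]];
    last exact: Wx.
    exact: weight_space0.
  by rewrite -[m1]scale1r -(rmorph1 (ucst (pe F 2))); apply: weight_spaceP.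
have [] // := @weight_indep _ wt s' nu x (m - \sum_(t <- s | wt t == nu) x t).
- exact: subseq_uniq us.
- by apply/mapP => -[t]; rewrite mem_filter => /andP[/eqP ne _] e; apply: ne.
- by rewrite addrC -scaleN1r -(rmorphN1 (ucst (pe F 2))); apply: weight_spaceP.
- by move=> t; rewrite mem_filter => /andP[_ /Wx].
by rewrite em (bigID (fun t => wt t == nu)) /= addrAC addrN add0r big_filter.
Qed.
End Weights.

(** * Weight spaces of a highest weight module *)

Section PhiWeights.
Variables (F : fieldType) (nu : 'rV[F]_2).
Hypothesis pchar0 : [pchar F] =i pred0.

(* (j, i) indexes the vector c^j f^i v. *)
Definition verma_weight (t : bool * nat) : 'rV[F]_2 :=
  \row_k (if k == 0 then nu 0 0 - (t.2)%:R - (t.1)%:R else nu 0 1 +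
    (t.2)%:R - (t.1)%:R).

Definition verma_basis (t : bool * nat) : {poly F} * {poly F} :=
  if t.1 then (0, 'X^(t.2)) else ('X^(t.2), 0).

Lemma natr_eq0_pchar0 k : (k%:R == 0 :> F) = (k == 0%N).
Proof. exact: (pcharf0P F).1 pchar0 k. Qed.

Lemma natr_inj_pchar0 : injective (fun k : nat => k%:R : F).
Proof.
have le_inj k l : (k <= l)%N -> k%:R = l%:R :> F -> k = l.
  move=> kl /eqP; rewrite -(subnK kl) natrD eq_sym -subr_eq0 addrK natr_eq0_pchar0.
  by move=> /eqP->.
move=> k l kl; case/orP: (leq_total k l) => h; first exact: le_inj.
by symmetry; apply: le_inj.
Qed.

Lemma two_neq0 : (2 : F) != 0.
Proof. by rewrite natr_eq0_pchar0. Qed.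

(** The first coordinate determines i + j and the second i - j. This is where weight multiplicity
    one comes from. *)
Lemma verma_weight_inj : injective verma_weight.
Proof.
move=> [j i] [j' i'] /rowP e; have := e 0; have := e 1; rewrite !mxE /= => e1 e0.
have {}e0 : (i + j)%N = (i' + j')%N.
  apply: natr_inj_pchar0; rewrite !natrD.
  by apply: oppr_inj; apply: (addrI (nu 0 0)); rewrite !opprD !addrA.
have {}e1 : (i + j')%N = (i' + j)%N.
  apply: natr_inj_pchar0; rewrite !natrD.
  apply/eqP; rewrite -subr_eq0; move/eqP: e1; rewrite -subr_eq0 => /eqP <-.
  by apply/eqP; ring.
have [ii' jj'] : i = i' /\ nat_of_bool j =
  j' by move: (nat_of_bool j) (nat_of_bool j') e0 e1; lia.
by move: e e0 e1 jj' => _ _ _; rewrite ii'; case: j j' => [] [].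
Qed.

Variables (M : lmodType (U (pe F 2))) (w : M).
Hypothesis hw : highest_weight nu w.

Lemma hw_map1Xn i : hw_map1 w 'X^i = ugen (pe_f F) ^+ i *: w.
Proof.
elim: i => [|i IH]; first by rewrite !expr0 hw_map1_1 scale1r.
by rewrite exprS hw_map1X IH scalerA -exprS.
Qed.

Lemma hw_map_verma_basis t : hw_map w (verma_basis t) =
  (if t.1 then ugen (pe_c F) else 1) *: (ugen (pe_f F) ^+ t.2 *: w).
Proof.
by case: t => [[] i]; rewrite /hw_map /verma_basis /= hw_map1_0 hw_map1Xn ?add0r //
  scaler0 addr0 scale1r.
Qed.

Lemma hw_map_weight t : weight_space (verma_weight t) (hw_map w (verma_basis t)).
Proof.
move=> h dh; rewrite (hw_map_pe_op two_neq0 hw).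
have diag (i j : 'I_(2 + 2)) : i != j :> nat ->
  sval h i j = 0 by move/is_diag_mxP: dh => dh; apply: dh.
have a01 : ulsubmx (sval h) 0 1 = 0 by rewrite !mxE diag.
have a10 : ulsubmx (sval h) 1 0 = 0 by rewrite !mxE diag.
have b0 : ursubmx (sval h) = 0.
  by apply/matrixP => i j; rewrite !mxE diag //=; case: (ord2P i) => ->.
have c0 : dlsubmx (sval h) 0 1 = 0 by rewrite !mxE diag.
have gl_opXn i : gl_op nu (ulsubmx (sval h)) 'X^i =
    wt_eval (verma_weight (false, i)) (sval h) *: 'X^i.
  rewrite /gl_op a01 a10 !scale0r !addr0 derivXn.
  (* For i = 0 the truncated predecessor gives the wrong exponent, but the factor i is then zero. *)
  have -> : 'X * ('X^(i.-1) *+ i) = i%:R *: 'X^i :> {poly F}.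
    by case: i => [|i]; rewrite ?mulr0n ?mulr0 ?scale0r // mulrnAr -exprS scaler_nat.
  rewrite scalerA -scalerDl /wt_eval sum2E !mxE /=; congr (_ *: _); ring.
suff -> : pe_op nu (sval h) (verma_basis t) =
  wt_eval (verma_weight t) (sval h) *: verma_basis t.
  by rewrite hw_mapZ.
rewrite /pe_op b0 mul0mx gl_op0l c0 scale0r !addr0.
case: t => [[] i]; rewrite /verma_basis /= gl_opXn; apply: injective_projections;
  rewrite /= ?linear0 ?scaler0 ?subr0 ?addr0 //.
rewrite -scalerBl; congr (_ *: _).
by rewrite /wt_eval !sum2E mxtrace2 !mxE /=; ring.
Qed.

Definition verma_basis_coef (v : {poly F} * {poly F}) (t : bool * nat) : F :=
  if t.1 then v.2`_(t.2) else v.1`_(t.2).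

Definition verma_basis_supp (v : {poly F} * {poly F}) : seq (bool * nat) :=
  [seq (j, i) | j <- [:: false; true], i <- iota 0 (maxn (size v.1) (size v.2))].

Lemma verma_basis_supp_uniq v : uniq (verma_basis_supp v).
Proof. by apply: allpairs_uniq; rewrite ?iota_uniq // => -[? ?] [? ?]. Qed.

Lemma hw_map_sum v :
  hw_map w v = \sum_(t <- verma_basis_supp v)
    ucst _ (verma_basis_coef v t) *: hw_map w (verma_basis t).
Proof.
rewrite /verma_basis_supp; set n := maxn _ _.
rewrite big_allpairs !big_cons big_nil /= addr0 /hw_map.
rewrite !(@hw_map1_widen _ _ w n) ?leq_max ?leqnn ?orbT //.
have -> : iota 0 n = index_iota 0 n by rewrite /index_iota subn0.
rewrite !big_mkord scaler_sumr; congr (_ + _); apply: eq_bigr => i _.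
  by rewrite -hw_map1Xn /= hw_map1_0 scaler0 addr0.
by rewrite scale_ucstC -hw_map1Xn /= hw_map1_0 add0r.
Qed.

Lemma hw_map_weight_sum v nu' : weight_space nu' (hw_map w v) ->
  hw_map w v =
  \sum_(t <- verma_basis_supp v | verma_weight t == nu')
    ucst _ (verma_basis_coef v t) *: hw_map w (verma_basis t).
Proof.
move=> Wv; apply: (weight_proj (wt := verma_weight) _ Wv _ (hw_map_sum v)) => [|t _].
  by rewrite map_inj_uniq ?verma_basis_supp_uniq //; apply: verma_weight_inj.
exact/weight_spaceZ/hw_map_weight.
Qed.

Lemma hw_map_weight_component v t : weight_space (verma_weight t) (hw_map w v) ->
  hw_map w v = ucst _ (if t \in verma_basis_supp v then verma_basis_coef v t else 0) *:
    hw_map w (verma_basis t).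
Proof.
move=> /hw_map_weight_sum ->; under eq_bigl => t' do rewrite (inj_eq verma_weight_inj).
case: ifP => ts.
  by rewrite -big_filter filter_pred1_uniq ?verma_basis_supp_uniq // big_seq1.
rewrite rmorph0 scale0r big1_seq // => t' /andP[/eqP->].
by rewrite ts.
Qed.

Lemma hw_map_weight_space_eq0 v nu' : (forall t, nu' <> verma_weight t) ->
  weight_space nu' (hw_map w v) -> hw_map w v = 0.
Proof.
move=> nunu' /hw_map_weight_sum ->.
by rewrite big1 // => t /eqP ee; case: (nunu' t).
Qed.

Hypothesis w_gen : forall m : M, exists v, m = hw_map w v.

(** The boolean is read as 0 or 1: a weight space is spanned by its one basis vector, so the
    character records exactly which basis vectors survive. *)
Lemma has_dim_verma_weight t :
  has_dim (@weight_space _ _ M (verma_weight t)) (hw_map w (verma_basis t) != 0).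
Proof.
have Wt m : weight_space (verma_weight t) m ->
  exists k, m = ucst _ k *: hw_map w (verma_basis t).
  by have [v ->] := w_gen m => /hw_map_weight_component ->; eexists.
case: (eqVneq _ 0) => [e|nz]; last exact: has_dim1 (hw_map_weight t) nz Wt.
by apply: has_dim0 => [|m /Wt[k ->]]; [exact: weight_space0 | rewrite e scaler0].
Qed.

Lemma has_dim_notin nu' : (forall t, nu' <> verma_weight t) ->
  has_dim (@weight_space _ _ M nu') 0.
Proof.
move=> nunu'; apply: has_dim0 => [|m]; first exact: weight_space0.
by have [v ->] := w_gen m; apply: hw_map_weight_space_eq0.
Qed.

Lemma hw_map_weight_module_fin : weight_module_fin M.
Proof.
split=> [m|nu'].
  have [v ->] := w_gen m; rewrite hw_map_sum.
  exists [seq ucst _ (verma_basis_coef v t) *: hw_map w (verma_basis t)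
    | t <- verma_basis_supp v]; rewrite big_map.
  split=> // x /mapP[t _ ->]; exists (verma_weight t).
  exact/weight_spaceZ/hw_map_weight.
case: (pselect (exists t, nu' = verma_weight t)) => [[t ->]|not].
  by eexists; apply: has_dim_verma_weight.
by exists 0; apply: has_dim_notin => t e; apply: not; exists t.
Qed.

Lemma ch_verma_weight t : ch M (verma_weight t) = (hw_map w (verma_basis t) != 0)%:Z.
Proof. by rewrite /ch (dimE _ (has_dim_verma_weight t)) //; apply: weight_space0. Qed.

Lemma ch_notin nu' : (forall t, nu' <> verma_weight t) -> ch M nu' = 0.
Proof. by move=> /has_dim_notin h; rewrite /ch (dimE _ h) //; apply: weight_space0. Qed.

End PhiWeights.

(** * Singular vectors *)

Section Vectors.
Variables (F : fieldType) (nu : 'rV[F]_2) (M : lmodType (U (pe F 2))) (w : M).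
Hypothesis two0 : (2 : F) != 0.
Hypothesis hw : highest_weight nu w.

Lemma gl_opXn_trig (a : 'M[F]_2) i : a 1 0 = 0 ->
  gl_op nu a 'X^(i.+1) = (a 0 0 * (nu 0 0 - (i.+1)%:R) + a 1 1 * (nu 0 1 +
    (i.+1)%:R)) *: 'X^(i.+1)
    + (a 0 1 * (i.+1)%:R * (nu 0 0 - nu 0 1 - i%:R)) *: 'X^i.
Proof.
move=> a10; have dX k : ('X^k)^`() = k%:R *: 'X^(k.-1) :> {poly F}.
  by rewrite derivXn scaler_nat.
have XdX k : 'X * ('X^k)^`() = k%:R *: 'X^k :> {poly F}.
  by rewrite dX; case: k => [|k]; rewrite ?scale0r ?mulr0 // -scalerAr -exprS.
rewrite /gl_op a10 scale0r addr0 XdX dX /= derivZ -scalerAr XdX.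
rewrite !scalerA -scalerBl scalerA -scalerDl; congr (_ *: _ + _ *: _); ring.
Qed.

(** The sl(2) identity for e f^(i+1). It holds on both copies, as e is traceless and so commutes
    with c. *)
Lemma e_verma_basis j i :
  ugen (pe_even (delta_mx 0 1)) *: hw_map w (verma_basis F (j, i.+1)) =
  ucst _ ((i.+1)%:R * (nu 0 0 - nu 0 1 - i%:R)) *: hw_map w (verma_basis F (j, i)).
Proof.
rewrite (hw_map_pe_op two0 hw) -hw_mapZ /pe_op /= !(block_mxKul, block_mxKur,
  block_mxKdl).
rewrite mul0mx gl_op0l mxtrace2.
congr (hw_map _ _); case: j; rewrite /verma_basis /= gl_opXn_trig ?mxE //=;
  apply: injective_projections;
    rewrite /= ?gl_op0r ?mxE /= ?(mul0r, mul1r, add0r, addr0, scale0r, scaler0, subr0,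
      oppr0) //.
Qed.

(** If f^(i+1) gave zero, applying e would make f^i give zero, since (i+1)(lambda - i) is
    invertible. *)
Lemma hw_map_verma_basis_neq0 j i : hw_map w (verma_basis F (j, 0)) != 0 ->
  [pchar F] =i pred0 ->
  (forall k, (k < i)%N -> nu 0 0 - nu 0 1 <> k%:R) ->
  hw_map w (verma_basis F (j, i)) != 0.
Proof.
move=> nz0 pchar0; elim: i => [//|i IH] nuk.
apply: contra_neq (IH (fun k ki => nuk k (ltnW ki))) => e.
have := e_verma_basis j i; rewrite e scaler0 => /esym; apply: ucst_eq0.
rewrite mulf_neq0 ?natr_eq0_pchar0 // subr_eq0.
by apply/eqP/nuk.
Qed.

Lemma sym_verma_basis (x : elt (pe F 2)) b Q : sval x = block_mx 0 b 0 0 ->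
  ugen x *: hw_map w (0, Q) = hw_map w (gl_op nu (b *m symp_mx F) Q, 0).
Proof.
move=> hx; rewrite (hw_map_pe_op two0 hw) /pe_op hx !(block_mxKul, block_mxKur,
  block_mxKdl).
by rewrite !gl_op0l mxtrace0 /= mxE !scale0r add0r subr0 addr0.
Qed.

Lemma hw_map_top : hw_map w (verma_basis F (false, 0)) = w.
Proof. by rewrite /hw_map /= hw_map1_0 scaler0 addr0 hw_map1_1. Qed.

Lemma hw_map_c_neq0 : w != 0 -> nu 0 0 <> nu 0 1 ->
  hw_map w (verma_basis F (true, 0)) != 0.
Proof.
move=> nzw nu01; apply: contra_neq nzw => e.
(* For this b the product b J is diag(-1, 1), so b c w = (nu_2 - nu_1) w. *)
have b_pe : block_mx 0 (delta_mx 0 1 + delta_mx 1 0 : 'M[F]_2) 0 0 \in carrier (pe F 2).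
  apply/in_peP; exists 0, (delta_mx 0 1 + delta_mx 1 0), 0.
  by rewrite !trmx0 oppr0 linearD /= !trmx_delta addrC.
have := @sym_verma_basis (pe_elt b_pe) _ 1 erefl.
rewrite -[(0, 1)]/(verma_basis F (true, 0)) e scaler0 => /esym.
rewrite gl_op1 !mulmx2E !mxE /= !(mulr0, mul0r, mulr1, mul1r, add0r, addr0, subr0,
  sub0r, scale0r).
rewrite oppr0 scale0r addr0 mulN1r addrC /hw_map /= hw_map1Z hw_map1_1 hw_map1_0
  scaler0 addr0.
by apply: ucst_eq0; rewrite subr_eq0 eq_sym; apply/eqP.
Qed.

Lemma fpow_verma_basis_eq0 k j i : hw_map w (verma_basis F (false, k)) = 0 ->
  (k <= i)%N -> hw_map w (verma_basis F (j, i)) = 0.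
Proof.
rewrite !hw_map_verma_basis /= scale1r => e /subnK <-.
by rewrite exprD -scalerA e !scaler0.
Qed.

(** The factor lambda - k in e f^(k+1) w vanishes, and g_1 kills every P(f) w. *)
Lemma singular_verma_basis k : nu 0 0 - nu 0 1 = k%:R ->
  highest_weight (verma_weight nu (false, k.+1))
    (hw_map w (verma_basis F (false, k.+1))).
Proof.
move=> nuk x /in_borelP[a [b [/is_trig_mxP ha hb hx]]].
have a10 : a 1 0 = 0 by have := ha 0 1 isT; rewrite mxE.
rewrite (hw_map_pe_op two0 hw) -hw_mapZ; congr (hw_map _ _).
rewrite /pe_op hx !(block_mxKul, block_mxKur, block_mxKdl) /verma_basis /= gl_opXn_trig
  // nuk subrr.
rewrite mulr0 scale0r addr0 !gl_op0r !scaler0 mxE scale0r !addr0 subr0.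
apply: injective_projections; rewrite /= ?scaler0 //; congr (_ *: _).
by rewrite /wt_eval sum2E block_mxKul !mxE /= !subr0; ring.
Qed.

(** For b in g_1, b c w = (b J) w: the diagonal of b J contributes its trace times nu_1, which is
    zero, its upper entry kills w, and its lower entry gives a multiple of f w = 0. *)
Lemma singular_c_basis : nu 0 0 = nu 0 1 -> hw_map w (verma_basis F (false, 1)) = 0 ->
  highest_weight (verma_weight nu (true, 0)) (hw_map w (verma_basis F (true, 0))).
Proof.
move=> nu01 e x /in_borelP[a [b [/is_trig_mxP ha hb hx]]].
have a10 : a 1 0 = 0 by have := ha 0 1 isT; rewrite mxE.
rewrite (hw_map_pe_op two0 hw) -hw_mapZ.
rewrite /pe_op hx !(block_mxKul, block_mxKur, block_mxKdl) /verma_basis /= !gl_op0r mxE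
  scale0r add0r addr0.
have trb : (b *m symp_mx F) 0 0 * nu 0 0 + (b *m symp_mx F) 1 1 * nu 0 1 = 0.
  by rewrite nu01 -mulrDl -mxtrace2 mxtrace_sym_symp_mx // mul0r.
rewrite !gl_op1 trb a10 !scale0r add0r addr0 mxtrace2 -scalerBl.
have -> : ((b *m symp_mx F) 1 0 *: 'X,
           (a 0 0 * nu 0 0 + a 1 1 * nu 0 1 - (a 0 0 + a 1 1)) *: 1)
   = (b *m symp_mx F) 1 0 *: verma_basis F (false, 1)
     + wt_eval (verma_weight nu (true, 0)) (block_mx a b 0 (- a^T)) *: (0, 1).
  apply: injective_projections; rewrite /= ?scaler0 ?addr0 ?add0r //; congr (_ *: _).
  by rewrite /wt_eval sum2E block_mxKul !mxE /=; ring.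
by rewrite hw_mapP e scaler0 add0r.
Qed.
End Vectors.

(** * Vanishing of singular vectors in simple modules *)

Section Simple.
Variables (F : fieldType) (L : lmodType (U (pe F 2))).
Hypothesis pchar0 : [pchar F] =i pred0.
Hypothesis simpleL : simple_module L.
Implicit Types (w u : L).

Lemma simple_hw_map_surj nu w : highest_weight nu w -> w != 0 ->
  forall m, exists v, m = hw_map w v.
Proof.
move=> hw nzw m; pose N : {pred L} := [pred y : L | `[< exists v, y = hw_map w v >]].
have inN y : (exists v, y = hw_map w v) -> y \in N by move=> ?; apply/asboolP.
have [|N0|NL] := simpleL.2 N; last by have /asboolP := NL m.
  split=> [|u x y /asboolP[v ->] /asboolP[v' ->]].
    by apply: inN; exists 0; rewrite hw_map0.
  have [v1 ->] := hw_map_surj_sub (two_neq0 pchar0) hw u v.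
  by apply: inN; exists (1 *: v1 + v'); rewrite hw_mapP rmorph1 scale1r.
by case/eqP: nzw; apply: N0; apply: inN; exists (verma_basis F (false, 0));
  rewrite hw_map_top.
Qed.

(** If u were nonzero it would generate L, so w would lie in the image of [hw_map u]. That image has
    no nonzero vector of weight mu. *)
Lemma highest_weight_eq0 mu nu w u : highest_weight mu w -> w != 0 ->
  highest_weight nu u -> (forall t, mu <> verma_weight nu t) -> u = 0.
Proof.
move=> hw nzw hu munu; apply/eqP/negPn/negP => nzu.
have [v ev] := simple_hw_map_surj hu nzu w.
case/eqP: nzw; rewrite ev; apply: (hw_map_weight_space_eq0 pchar0 hu munu).
rewrite -ev -(hw_map_top w); have := hw_map_weight pchar0 hw (false, 0).
by congr (weight_space _ _); apply/rowP => i; case: (ord2P i) => ->;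
  rewrite mxE /= ?subr0 ?addr0.
Qed.

End Simple.

(** * The canonical generator and basis of the Verma module *)

Section Verma.
Variables (F : fieldType) (nu : 'rV[F]_2).
Hypothesis pchar0 : [pchar F] =i pred0.

Definition vtop : verma nu := pure (borel_incl F) 1 ((1 : F) : one_dim nu).

Lemma verma_scale_pure (u u' : U (pe F 2)) (k : one_dim nu) :
  u *: (pure (borel_incl F) u' k : verma nu) = pure (borel_incl F) (u * u') k.
Proof. by rewrite /pure (tpi_scale (borel_incl F) u (TPure u' k)). Qed.

Lemma verma_gen (z : verma nu) : exists u, z = u *: vtop.
Proof.
have [t ->] := tpi_surj z; elim: t => [u k||t [u e]|t [u e] t' [u' e']].
(* The scalar k is moved across the tensor sign: u (x) k = u k (x) 1. *)
- exists (u * (borel_incl F) (ucst _ (k : F))); rewrite /vtop verma_scale_pure mulr1.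
  apply/tpiP; apply: te_trans; last exact/te_sym/te_pureM.
  suff -> : ucst (borel F 2) (k : F) *: ((1 : F) : one_dim nu) = k by apply: te_refl.
  by rewrite /GRing.scale /= /one_dim_scale bchar_pi /= mulr1.
- by exists 0; rewrite scale0r.
- by exists (- u); rewrite scaleNr -e tpi_opp.
- by exists (u + u'); rewrite scalerDl -e -e' tpi_add.
Qed.

Lemma vtop_hw : highest_weight nu vtop.
Proof.
move=> x bx; rewrite /vtop !verma_scale_pure !mulr1; apply/tpiP.
have -> : ugen x = 1 * (borel_incl F) (ugen (exist _ (sval x) bx : elt (borel F 2))).
  rewrite mul1r uincl_pi /=; congr (ugen _).
  by apply/val_inj.
have -> : ucst (pe F 2) (wt_eval nu (sval x)) =
    1 * (borel_incl F) (ucst (borel F 2) (wt_eval nu (sval x))).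
  by rewrite mul1r uincl_pi.
apply: te_trans; first exact: te_pureM.
apply: te_trans; last exact/te_sym/te_pureM.
suff -> : ugen (exist _ (sval x) bx : elt (borel F 2)) *: ((1 : F) : one_dim nu) =
  ucst (borel F 2) (wt_eval nu (sval x)) *: ((1 : F) : one_dim nu) by apply: te_refl.
by rewrite /GRing.scale /= /one_dim_scale !bchar_pi.
Qed.

Lemma verma_hw_map (z : verma nu) : exists v, z = hw_map vtop v.
Proof.
have [u ->] := verma_gen z; have := hw_map_surj_sub (two_neq0 pchar0) vtop_hw u.
by move=> /(_ (verma_basis F (false, 0))); rewrite hw_map_top.
Qed.

Lemma verma_coord0 : verma_coord (0 : verma nu) = 0.
Proof. by rewrite /verma_coord (verma_eval_equiv (two_neq0 pchar0) (trepr_pi _ _)). Qed.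

(** In place of the Poincaré-Birkhoff-Witt theorem: [verma_coord] sends c^j f^i v to the monomial of
    degree i in component j of the model. *)
Lemma verma_basis_neq0 t : hw_map vtop (verma_basis F t) != 0.
Proof.
apply/eqP => /(congr1 (@verma_coord F nu));
  rewrite verma_coord0 hw_map_verma_basis scalerA.
rewrite /vtop verma_scale_pure mulr1 verma_coord_pure ?two_neq0 //.
have actf i : actU nu (ugen (pe_f F) ^+ i) (1, 0) = ('X^i, 0).
  elim: i => [|i IH].
    by rewrite expr0 /= (actU_pi nu (two_neq0 pchar0) (UCst _ 1)) /= scale1r.
  rewrite exprS actUM ?two_neq0 // IH (actU_pi nu (two_neq0 pchar0) (UGen _)) /=.
  rewrite /pe_op !(block_mxKul, block_mxKur, block_mxKdl) /= gl_op_f mul0mx gl_op0l mxE.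
  by rewrite gl_op0r !scaler0 scale0r !addr0 subr0 exprS.
rewrite actUM ?two_neq0 // actf; case: t => [[] i] /=.
  rewrite (actU_pi nu (two_neq0 pchar0) (UGen _)) /= /pe_op.
  rewrite !(block_mxKul, block_mxKur, block_mxKdl) /= => /(congr1 snd) /=.
  rewrite !gl_op0l mxtrace0 scaler0 subr0 add0r mxE subr0 scale1r.
  by move/eqP; rewrite expf_eq0 polyX_eq0 andbF.
rewrite (actU_pi nu (two_neq0 pchar0) (UCst _ 1)) /= scale1r => /(congr1 fst) /=.
by move/eqP; rewrite expf_eq0 polyX_eq0 andbF.
Qed.

End Verma.

(** * The simple quotient *)

Lemma hw_map_linear (F : fieldType) (M N : lmodType (U (pe F 2)))
    (p : {linear M -> N}) w v :
  p (hw_map w v) = hw_map (p w) v.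
Proof.
rewrite /hw_map linearD linearZ /hw_map1 !linear_sum /=.
by congr (_ + _ *: _); apply: eq_bigr => i _; rewrite !linearZ.
Qed.

Section SimpleQuotient.
Variables (F : fieldType) (mu : 'rV[F]_2) (L : lmodType (U (pe F 2))).
Variable p : {linear verma mu -> L}.
Hypothesis pchar0 : [pchar F] =i pred0.
Hypothesis simple_p : simple_quotient p.

Let w := p (vtop mu).
Let two0 := two_neq0 pchar0.

Lemma quotient_hw : highest_weight mu w.
Proof. by move=> x bx; have := congr1 p (@vtop_hw F mu x bx); rewrite !linearZ. Qed.

Lemma quotient_hw_map m : exists v, m = hw_map w v.
Proof.
have [x <-] := simple_p.2 m; have [v ->] := verma_hw_map pchar0 x.
by exists v; rewrite hw_map_linear.
Qed.

Lemma quotient_hw_neq0 : w != 0.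
Proof.
apply/eqP => w0; have [[x nzx] _] := simple_p.1; case/eqP: nzx.
have [y <-] := simple_p.2 x; have [u ->] := verma_gen y.
by rewrite linearZ /= -/w w0 scaler0.
Qed.

Lemma quotient_verma_basis_neq0 j i : ~~ j || (mu 0 0 != mu 0 1) ->
  (forall k, (k < i)%N -> mu 0 0 - mu 0 1 <> k%:R) ->
    hw_map w (verma_basis F (j, i)) != 0.
Proof.
move=> hj; apply: (hw_map_verma_basis_neq0 two0 quotient_hw) => //.
case: j hj => [/eqP hj|_]; last by rewrite hw_map_top quotient_hw_neq0.
exact: (hw_map_c_neq0 two0 quotient_hw quotient_hw_neq0).
Qed.

Lemma quotient_bijective : (forall k : nat, mu 0 0 - mu 0 1 <> k%:R) -> bijective p.
Proof.
move=> nuk; have p_inj : injective p.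
  apply: raddf_inj => x; have [v ->] := verma_hw_map pchar0 x; move=> pv0.
  have {}pv0 : hw_map w v = 0 by rewrite /w -hw_map_linear.
  rewrite (hw_map_sum _ v) big1_seq // => t /= ts.
  suff -> : verma_basis_coef v t = 0 by rewrite rmorph0 scale0r.
  (* The zero vector lies in every weight space, so each coefficient of v can be isolated in
     turn. *)
  have Wt : weight_space (verma_weight mu t) (hw_map w v) by rewrite pv0;
    apply: weight_space0.
  have := hw_map_weight_component pchar0 quotient_hw Wt; rewrite ts pv0 => /esym e.
  apply/eqP; apply: contraT => /ucst_eq0 /(_ e) e'.
  suff : hw_map w (verma_basis F t) != 0 by rewrite e' eqxx.
  case: t {ts Wt e e'} => j i; apply: quotient_verma_basis_neq0 => //.
  by rewrite -subr_eq0; apply/orP; right; apply/eqP; apply: (nuk 0%N).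
have /choice[g gK] : forall y, exists x, p x = y by exact: simple_p.2.
by exists g => // x; apply: p_inj; rewrite gK.
Qed.

Lemma verma_weight_shiftE k j i : verma_weight (verma_weight mu (false, k)) (j, i) =
  verma_weight mu (j, (k + i)%N).
Proof.
by apply/rowP => l; rewrite !mxE /=; case: ifP => _; rewrite natrD; ring.
Qed.

Lemma verma_weight_shift k j i t : verma_weight (verma_weight mu (false, k)) (j, i) =
  verma_weight mu t ->
  t = (j, (k + i)%N).
Proof. by rewrite verma_weight_shiftE => /(verma_weight_inj pchar0). Qed.

Lemma verma_weight0 : verma_weight mu (false, 0) = mu.
Proof. by apply/rowP => i; case: (ord2P i) => ->; rewrite mxE /= ?subr0 ?addr0. Qed.

(** The singular vector f^(k+1) w generates only weights of index (j, k+1+i), while mu has index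
    (false, 0). *)
Lemma quotient_singular k : mu 0 0 - mu 0 1 = k%:R ->
  hw_map w (verma_basis F (false, k.+1)) = 0.
Proof.
move=> muk.
apply: (highest_weight_eq0 pchar0 simple_p.1 quotient_hw quotient_hw_neq0
  (singular_verma_basis two0 quotient_hw muk)) => -[j i].
by rewrite -[LHS]verma_weight0 => /esym/verma_weight_shift.
Qed.

Lemma quotient_verma_basis k j i : (0 < k)%N -> mu 0 0 - mu 0 1 = k%:R ->
  (hw_map w (verma_basis F (j, i)) != 0) = (i <= k)%N.
Proof.
move=> k0 muk; case: leqP => ik; last first.
  by apply/eqP; apply: fpow_verma_basis_eq0 (quotient_singular muk) ik.
apply: quotient_verma_basis_neq0.
  by rewrite -subr_eq0 muk natr_eq0_pchar0 // -lt0n k0 orbT.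
move=> l li; rewrite muk => /(natr_inj_pchar0 pchar0) kl.
by rewrite -kl ltnNge ik in li.
Qed.

Lemma sdot_verma_weight k : mu 0 0 - mu 0 1 = k%:R ->
  sdot mu = verma_weight mu (false, k.+1).
Proof.
move=> muk; have mu00 : mu 0 0 = k%:R + mu 0 1 by rewrite -muk subrK.
rewrite sdotE //; apply/rowP => l; rewrite /eps !mxE /= mu00.
by case: (ord2P l) => -> /=; rewrite -natr1; ring.
Qed.

Lemma quotient_fin : weight_module_fin L.
Proof. exact (hw_map_weight_module_fin pchar0 quotient_hw quotient_hw_map). Qed.

(** Outside the weights of M_mu all terms are 0. At the weight of c^j f^i v the identity is 1 = 1 -
    0 if i <= k, and 0 = 1 - 1 if i > k, where the weight is that of index (j, i-k-1) in the Verma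
    module of s.mu. *)
Lemma ch_quotient k nu : (0 < k)%N -> mu 0 0 - mu 0 1 = k%:R ->
  ch L nu = ch (verma mu) nu - ch (verma (sdot mu)) nu.
Proof.
move=> k0 muk; rewrite (sdot_verma_weight muk).
case: (pselect (exists t, nu = verma_weight mu t)) => [[[j i] ->]|nonu]; last first.
  have notin t : nu <> verma_weight mu t by move=> e; apply: nonu; exists t.
  rewrite (ch_notin pchar0 quotient_hw quotient_hw_map notin).
  rewrite (ch_notin pchar0 (@vtop_hw F mu) (@verma_hw_map F mu pchar0) notin) sub0r.
  rewrite (ch_notin pchar0 (@vtop_hw F _) (@verma_hw_map F _ pchar0)) ?oppr0 // =>
    -[j i] e.
  by apply: (notin (j, (k.+1 + i)%N)); rewrite e verma_weight_shiftE.
rewrite (ch_verma_weight pchar0 quotient_hw quotient_hw_map) (quotient_verma_basis _ _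
  k0 muk).
rewrite (ch_verma_weight pchar0 (@vtop_hw F mu) (@verma_hw_map F mu pchar0))
  verma_basis_neq0 //.
case: leqP => ik.
  rewrite (ch_notin pchar0 (@vtop_hw F _) (@verma_hw_map F _ pchar0)) ?subr0 // =>
    -[j' i'].
  by move=> /esym/verma_weight_shift[_ ii']; move: ik;
    rewrite ii' -ltnS addSn ltnNge leq_addr.
have -> : verma_weight mu (j, i) =
  verma_weight (verma_weight mu (false, k.+1)) (j, (i - k.+1)%N).
  by rewrite verma_weight_shiftE subnKC.
by rewrite (ch_verma_weight pchar0 (@vtop_hw F _) (@verma_hw_map F _ pchar0))
  verma_basis_neq0 // subrr.
Qed.

Lemma ch_quotient_trivial nu : mu 0 0 = mu 0 1 -> ch L nu = fexp mu nu.
Proof.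
move=> mu01; have mu0 : mu 0 0 - mu 0 1 = 0%:R by rewrite mu01 subrr.
have f0 := quotient_singular mu0.
have c0 : hw_map w (verma_basis F (true, 0)) = 0.
  apply: (highest_weight_eq0 pchar0 simple_p.1 quotient_hw quotient_hw_neq0
    (singular_c_basis two0 quotient_hw mu01 f0)) => -[j i] /rowP e.
  have := e 0; have := e 1; rewrite !mxE /= => e1 e0.
  (* Compare coordinate sums: each c lowers the sum by 2 and f preserves it, so mu below the weight
     of c w would force 2 + 2j = 0. *)
  have /eqP : (2 + 2 * j)%:R = 0 :> F.
    have := congr1 (fun z => mu 0 0 - z) e0; rewrite subrr => {}e0.
    have := congr1 (fun z => mu 0 1 - z) e1; rewrite subrr => {}e1.
    by have := congr2 +%R e0 e1; rewrite addr0 => e'; rewrite [RHS]e' natrD natrM; ring.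
  by rewrite natr_eq0_pchar0.
have notbase j i : (j, i) != (false, 0) -> hw_map w (verma_basis F (j, i)) = 0.
  (* Indices with i > 0 die with f w, and the only other index apart from the top is that of c w. *)
  case: i => [|i] ji; last exact: fpow_verma_basis_eq0 f0 _.
  by case: j ji => // _.
case: (pselect (exists t, nu = verma_weight mu t)) => [[[j i] ->]|nonu]; last first.
  rewrite (ch_notin pchar0 quotient_hw quotient_hw_map) => [|t e];
    last by apply: nonu; exists t.
  rewrite /fexp; case: eqP => // nue; case: nonu; exists (false, 0).
  by rewrite nue verma_weight0.
have vmu : (verma_weight mu (j, i) == mu) = ((j, i) == (false, 0)).
  by rewrite -{2}verma_weight0 (inj_eq (verma_weight_inj pchar0 (nu := mu))).
rewrite (ch_verma_weight pchar0 quotient_hw quotient_hw_map) /fexp vmu.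
have [[-> ->]|/notbase ->] := eqVneq (j, i) (false, 0); last by rewrite eqxx.
by rewrite hw_map_top quotient_hw_neq0.
Qed.

End SimpleQuotient.

(** L_mu is given by an arbitrary simple quotient map p. The character identities come with
    [weight_module_fin], which gives [ch] its meaning. *)
Theorem corollary6p2 (R : realType) (mu : 'rV[R[i]%C]_2)
    (L : lmodType (U (pe R[i]%C 2))) (p : {linear verma mu -> L}) :
  simple_quotient p ->
  [/\ (forall k : nat, mu 0 0 - mu 0 1 <> k%:R) -> bijective p,
      (exists2 k : nat, (0 < k)%N & mu 0 0 - mu 0 1 = k%:R) ->
        [/\ weight_module_fin L, weight_module_fin (verma mu),
            weight_module_fin (verma (sdot mu))
          & forall nu, ch L nu = ch (verma mu) nu - ch (verma (sdot mu)) nu]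
    & mu 0 0 = mu 0 1 ->
        weight_module_fin L /\ forall nu, ch L nu = fexp mu nu].
Proof.
move=> simple_p; have pchar0 := Num.Theory.pchar_num R[i]%C.
have fin_verma (nu : 'rV[R[i]%C]_2) : weight_module_fin (verma nu).
  exact (hw_map_weight_module_fin pchar0 (@vtop_hw _ nu) (@verma_hw_map _ nu pchar0)).
split=> [|[k k0 muk]|mu01].
- exact: (quotient_bijective pchar0 simple_p).
- split=> // [|nu]; first exact: (quotient_fin pchar0 simple_p).
  exact: (ch_quotient pchar0 simple_p nu k0 muk).
- split=> [|nu]; first exact: (quotient_fin pchar0 simple_p).
  exact: (ch_quotient_trivial pchar0 simple_p nu mu01).
Qed.
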